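(* Let $\vartheta_{\mathbf{P}}$ be a primitive random substitution with Perron--Frobenius eigenvalue $\lambda$ and right Perron--Frobenius eigenvector $\mathbf{R}$, and let $\mu_{\mathbf{P}}$ be its frequency measure on $(X_{\vartheta},S)$. Then, for all $k\in\mathbb{N}$, $$\frac{1}{\lambda^k}\,\mathbf{H}_k^{\top}\mathbf{R}-H(\lambda^{-k})\;\le\; h(\mu_{\mathbf{P}})\;\le\;\frac{1}{\lambda^k-1}\,\mathbf{H}_k^{\top}\mathbf{R}.$$ In particular, $$h(\mu_{\mathbf{P}})=\lim_{k\to\infty}\frac{1}{\lambda^k}\,\mathbf{H}_k^{\top}\mathbf{R}.$$
   Context: $\mathbb{N}=\{1,2,\dots\}$. $\mathcal{A}=\{a_1,\dots,a_d\}$ is a finite alphabet, $\mathcal{A}^+$ the set of non-empty finite words, $|u|$ the length of a word $u$, and $|u|_v$ the number of (possibly overlapping) occurrences of $v$ as a subword of $u$. A random substitution $\vartheta_{\mathbf{P}}=(\vartheta,\mathbf{P})$ is a map $\vartheta$ assigning to each letter $a_i$ a non-empty finite set $\vartheta(a_i)=\{s^{(i,1)},\dots,s^{(i,r_i)}\}\subset\mathcal{A}^+$ of $r_i$ distinct words, together with probability vectors $\mathbf{p}_i=(p_{i,1},\dots,p_{i,r_i})$ with all $p_{i,j}>0$; $\vartheta_{\mathbf{P}}(a_i)$ is the random word equal to $s^{(i,j)}$ with probability $p_{i,j}$. It is extended to words by applying it independently to each letter and concatenating the results; $(\vartheta_{\mathbf{P}}^n(u))_{n}$ is the Markov chain obtained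 by iterating this with fresh independent choices at each step, starting from $u$. $\mathbb{P},\mathbb{E}$ denote the corresponding probability and expectation, and $\vartheta^n(u)=\{v:\mathbb{P}[\vartheta_{\mathbf{P}}^n(u)=v]>0\}$. The substitution matrix is $M\in\mathbb{R}^{d\times d}$, $M_{i,j}=\mathbb{E}[|\vartheta_{\mathbf{P}}(a_j)|_{a_i}]$. $\vartheta_{\mathbf{P}}$ is primitive if $M$ is primitive (some power has all entries positive) and its Perron--Frobenius eigenvalue satisfies $\lambda>1$. $\mathbf{R}$ is the right Perron--Frobenius eigenvector of $M$, with positive entries summing to $1$. The language $\mathcal{L}_\vartheta$ is the set of words occurring as subwords of some word in $\vartheta^k(a)$, $a\in\mathcal{A}$, $k\in\mathbb{N}$; $\mathcal{L}_\vartheta^n=\mathcal{L}_\vartheta\cap\mathcal{A}^n$. $X_\vartheta\subset\mathcal{A}^{\mathbb{Z}}$ is the set of bi-infinite sequences all of whose finite subwords lie in $\mathcal{L}_\vartheta$, and $S$ is the left shift, $S(x)_i=x_{i+1}$. For $v\in\mathcal{L}_\vartheta$, $[v]=\{x\in X_\vartheta: x_0\cdots x_{|v|-1}=v\}$. The frequency measure $\mu_{\mathbf{P}}$ is the unique shift-invariant Borel probability measure on $X_\vartheta$ with $\mu_{\mathbf{P}}([v])=\lim_{k\to\infty}\mathbb{E}[|\vartheta_{\mathbf{P}}^k(a)|_v]/\mathbb{E}[|\vartheta_{\mathbf{P}}^k(a)|]$ for all $v\in\mathcal{L}_\vartheta$ (the limit exists and is independent of $a\in\mathcal{A}$; $\mu_{\mathbf{P}}$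 is ergodic). Its entropy is $h(\mu_{\mathbf{P}})=\lim_{n\to\infty}\frac1n\sum_{u\in\mathcal{L}_\vartheta^n}-\mu_{\mathbf{P}}([u])\log\mu_{\mathbf{P}}([u])$. $\mathbf{H}_m=(H_{m,a})_{a\in\mathcal{A}}$ is the vector with $H_{m,a}=\sum_{w\in\vartheta^m(a)}-\mathbb{P}[\vartheta_{\mathbf{P}}^m(a)=w]\log\mathbb{P}[\vartheta_{\mathbf{P}}^m(a)=w]$, the Shannon entropy of $\vartheta_{\mathbf{P}}^m(a)$. For $p\in(0,1)$, $H(p)=-p\log p-(1-p)\log(1-p)$. *)

(* Defs.v *)
From HB Require Import structures.
From mathcomp Require Import all_boot all_order all_algebra.
From mathcomp Require Import complex.
From mathcomp Require Import all_classical all_reals all_analysis.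

Set Implicit Arguments.
Unset Strict Implicit.
Unset Printing Implicit Defensive.

Import Order.TTheory GRing.Theory Num.Theory.
Import numFieldNormedType.Exports.

Local Open Scope classical_set_scope.
Local Open Scope ring_scope.

(** * Finitely supported probability distributions *)

(** A random element with finitely many outcomes is the list of its outcomes
    with their weights. The same value may be listed several times: its
    probability [Pr D x] is then the sum of the corresponding weights. *)
Definition fdist (R : realType) (T : Type) := seq (T * R).

Definition Pr (R : realType) (T : eqType) (D : fdist R T) (x : T) : R :=
  \sum_(y <- D | y.1 == x) y.2.

Definition Ex (R : realType) (T : Type) (D : fdist R T) (f : T -> R) : R :=
  \sum_(y <- D) y.2 * f y.1.

Definition fsupp (R : realType) (T : eqType) (D : fdist R T) : seq T :=
  undup [seq x <- [seq y.1 | y <- D] | 0 < Pr D x].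

Definition shannon (R : realType) (T : eqType) (D : fdist R T) : R :=
  \sum_(x <- fsupp D) - (Pr D x * ln (Pr D x)).

Definition fret (R : realType) (T : Type) (x : T) : fdist R T := [:: (x, 1)].

(** Draw [x] from [D], then draw from [f x] using fresh randomness. *)
Definition fbind (R : realType) (T U : Type)
    (D : fdist R T) (f : T -> fdist R U) : fdist R U :=
  flatten [seq [seq (y.1, x.2 * y.2) | y <- f x.1] | x <- D].

Definition binary_entropy (R : realType) (p : R) : R :=
  - (p * ln p) - (1 - p) * ln (1 - p).

(** * Random substitutions *)

(** The alphabet is ['I_d.+1]. The letter [a] is sent to the [rs_card a]
    distinct nonempty words [rs_image a j], with probabilities [rs_prob a j];
    [rs_prob_sum1] forces [rs_card a] to be positive. *)
Record random_substitution (R : realType) (d : nat) := RandomSubstitution {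
  rs_card : 'I_d.+1 -> nat;
  rs_image : forall a : 'I_d.+1, 'I_(rs_card a) -> seq 'I_d.+1;
  rs_prob : forall a : 'I_d.+1, 'I_(rs_card a) -> R;
  rs_image_neq0 : forall a (j : 'I_(rs_card a)), rs_image j != [::];
  rs_image_inj : forall a : 'I_d.+1, injective (@rs_image a);
  rs_prob_gt0 : forall a (j : 'I_(rs_card a)), 0 < rs_prob j;
  rs_prob_sum1 : forall a : 'I_d.+1, \sum_(j < rs_card a) rs_prob j = 1
}.

Section RandomSubstitution.
Context (R : realType) (d : nat).
Local Notation letter := 'I_d.+1.
Local Notation word := (seq letter).
Implicit Types (theta : random_substitution R d) (a : letter) (u v w : word).

Definition subst_letter theta a : fdist R word :=
  [seq (rs_image j, rs_prob j) | j <- enum 'I_(rs_card theta a)].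

Fixpoint subst_word theta u : fdist R word :=
  if u is a :: u' then
    fbind (subst_letter theta a) (fun v =>
      fbind (subst_word theta u') (fun w => fret R (v ++ w)))
  else fret R [::].

(** The law at time [n] of the Markov chain started at [u]. *)
Definition subst_iter theta (n : nat) u : fdist R word :=
  iter n (fun D => fbind D (subst_word theta)) (fret R u).

(** Number of possibly overlapping occurrences of [v] in [u]. *)
Definition occ v u : nat := count (fun i => prefix v (drop i u)) (iota 0 (size u)).

Definition subst_matrix theta : 'M[R]_d.+1 :=
  \matrix_(i, j) Ex (subst_letter theta j) (fun w => (occ [:: i] w)%:R).

Definition primitive_mx (M : 'M[R]_d.+1) : Prop :=
  exists k : nat, (0 < k)%N /\ forall i j, 0 < (M ^+ k) i j.

(** The Perron--Frobenius eigenvalue is the real eigenvalue that has maximal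
    modulus among all complex eigenvalues. *)
Definition PF_eigenvalue (M : 'M[R]_d.+1) (lambda : R) : Prop :=
  eigenvalue M lambda /\
  forall z : R[i],
    eigenvalue (map_mx (real_complex R) M) z -> `|z| <= real_complex R lambda.

Definition right_PF_eigenvector (M : 'M[R]_d.+1) (lambda : R)
    (v : 'cV[R]_d.+1) : Prop :=
  [/\ M *m v = lambda *: v,
      forall i, 0 < v i 0
    & \sum_i v i 0 = 1].

Definition primitive_subst theta : Prop :=
  primitive_mx (subst_matrix theta) /\
  exists2 lambda, PF_eigenvalue (subst_matrix theta) lambda & 1 < lambda.

Definition language theta : set word :=
  [set w | exists k a v, [/\ (0 < k)%N,
     0 < Pr (subst_iter theta k [:: a]) v & infix w v]].

Definition entropy_vec theta (m : nat) : 'cV[R]_d.+1 :=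
  \col_a shannon (subst_iter theta m [:: a]).

End RandomSubstitution.

(** * The subshift and its frequency measure *)

(** Bi-infinite sequences, with the product of the discrete topologies. *)
Definition bi_sequence (d : nat) : Type := {ptws int -> discrete_topology 'I_d.+1}.

HB.instance Definition _ (d : nat) := Topological.on (bi_sequence d).
HB.instance Definition _ (d : nat) :=
  isPointed.Build (bi_sequence d) (fun=> ord0).

Notation full_shift d := (g_sigma_algebraType (@open (bi_sequence d))).

Definition left_shift (d : nat) (x : full_shift d) : full_shift d :=
  fun i => x (i + 1).

(** The word [x_i x_(i+1) ... x_(i+n-1)]. *)
Definition word_at (d : nat) (x : full_shift d) (i : int) (n : nat) :
    seq 'I_d.+1 :=
  [seq x (i + j%:Z) | j <- iota 0 n].

Section FrequencyMeasure.
Context (R : realType) (d : nat).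
Implicit Types (theta : random_substitution R d) (mu : probability (full_shift d) R).

Definition subshift theta : set (full_shift d) :=
  [set x | forall i n, language theta (word_at x i n)].

Definition cylinder theta (v : seq 'I_d.+1) : set (full_shift d) :=
  [set x | subshift theta x /\ word_at x 0 (size v) = v].

(** Borel probability measures on the closed set [subshift theta] are
    represented by the Borel probability measures on the full shift that give
    it mass 1. *)
Definition frequency_measure theta mu : Prop :=
  [/\ mu (subshift theta) = 1%E,
      forall B : set (full_shift d), measurable B ->
        mu (@left_shift d @^-1` B) = mu B
    & forall v, language theta v -> forall a : 'I_d.+1,
        (fun k : nat =>
           Ex (subst_iter theta k [:: a]) (fun w => (occ v w)%:R) /
           Ex (subst_iter theta k [:: a]) (fun w => (size w)%:R))
        @ \oo --> fine (mu (cylinder theta v))].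

Definition measure_entropy theta mu : R :=
  limn (fun n : nat => n%:R^-1 *
    \sum_(u : n.-tuple 'I_d.+1 | `[< language theta u >])
      - (fine (mu (cylinder theta u)) * ln (fine (mu (cylinder theta u))))).

End FrequencyMeasure.

(* Main.v *)
Require Import Defs.
From mathcomp Require Import all_boot all_order all_algebra.
From mathcomp Require Import complex.
From mathcomp Require Import all_classical all_reals all_analysis.
From mathcomp Require Import ring lra zify.

Set Implicit Arguments.
Unset Strict Implicit.
Unset Printing Implicit Defensive.

Import Order.TTheory GRing.Theory Num.Theory.
Import numFieldNormedType.Exports.

Local Open Scope classical_set_scope.
Local Open Scope ring_scope.

(** Let [theta^m(a)] denote the random image of the letter [a] after [m] steps,
    [H_m] the mean of its Shannon entropy over a letter [a] drawn with the
    Perron--Frobenius weights, and [s_m = lambda^-m H_m]. With these weights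
    additive functionals of a word grow exactly like [lambda^m] ([pf_mean_sum]),
    so every estimate below is free of error terms in the growth rate. The
    measure is only used through the numbers [p v], the measures of cylinders,
    which are limits of mean word frequencies ([cvg_frequency]); [E_n] denotes
    the entropy of [p] on words of length [n].

    The main tool is Gibbs' inequality ([gibbs]): exhibiting a code bounds the
    entropy. The codes below have lengths that are additive, or subadditive,
    along a word, so that only mean frequencies matter and no law of large
    numbers is needed.

    - Running the chain for [m] and then [k] steps reveals at least the final
      word: [H_(m+k) <= H_m + lambda^m H_k] ([pf_entropyD_le]).
    - Conversely the images of the letters of [theta^m(a)], kept apart, are
      determined by the final word together with its cut points. Marking cuts
      with probability [q = lambda^-k] describes the latter, whence
      [lambda^m H_k <= H_(m+k) + lambda^(m+k) H(q)] ([pf_entropyD_ge]).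
    - The transition probabilities of [p] code the word [theta^m(a)] at an
      asymptotic cost of [E_(n+1) - E_n] per letter, so
      [limsup s_m <= E_(n+1) - E_n] ([entropy_le_increment]); telescoping,
      [limsup s_m <= E_n / n].
    - A word of length [n] seen in a long image is, up to bounded pieces at its
      ends, a concatenation of images of letters under [theta^m]. Coding these
      one by one gives [E_n <= n (s_m + O(lambda^-m)) + O_m(1)]
      ([word_entropy_le]).

    The last two points force [s_m] and [E_n / n] to have the common limit
    [inf E_n / n], which is the entropy of the measure. Letting [m] tend to
    infinity in the first two, after division by [lambda^(m+k)], gives the two
    bounds for each [k]. *)

(** * Gibbs' inequality for finitely supported laws *)

Lemma sum_fibers (V : nmodType) (T U : eqType) (s : seq T) (h : T -> U)
    (F : T -> V) :
  \sum_(x <- s) F x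
    = \sum_(y <- undup [seq h x | x <- s]) \sum_(x <- s | h x == y) F x.
Proof.
rewrite (exchange_big_dep predT) //= big_seq [RHS]big_seq.
apply: eq_bigr => x xs; rewrite -big_filter.
under eq_filter do rewrite eq_sym.
by rewrite filter_pred1_uniq ?undup_uniq ?mem_undup ?map_f// big_seq1.
Qed.

Lemma ler_sum_subset (R : numDomainType) (T : eqType) (s t : seq T) (F : T -> R) :
  uniq s -> {subset s <= t} -> (forall x, 0 <= F x) ->
  \sum_(x <- s) F x <= \sum_(x <- t) F x.
Proof.
move=> us st F0; elim: s t us st => [|x s IH] t /=.
  by move=> _ _; rewrite big_nil sumr_ge0.
move=> /andP[xs us] st; have xt : x \in t by rewrite st ?mem_head.
rewrite big_cons (perm_big _ (perm_to_rem xt)) big_cons lerD2l IH// => y ys.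
have := st y; rewrite inE ys orbT (perm_mem (perm_to_rem xt)) inE => /(_ isT).
by case/predU1P => // yx; rewrite yx (negPf xs) in ys.
Qed.

Section FiniteLaws.
Context (R : realType).

(** The concavity of the logarithm in the form [1 + x <= exp x], arranged so that
    summing over a law [p] and a code [q] gives Gibbs' inequality. *)
Lemma entropy_term_le (p q : R) : 0 <= p -> 0 < q ->
  - (p * ln p) <= - (p * ln q) + (q - p).
Proof.
rewrite le_eqVlt => /predU1P[<-|p0] q0; first by rewrite !mul0r subr0 oppr0 add0r ltW.
have := @expR_ge1Dx R (ln q - ln p).
rewrite expRD expRN !lnK ?posrE// => h.
have : p * (1 + (ln q - ln p)) <= p * (q / p) by rewrite ler_pM2l.
rewrite mulrCA divff ?gt_eqF// mulr1; lra.
Qed.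

(** Weights are required to be positive, rather than nonnegative, so that the
    listed outcomes are exactly the values of positive probability. *)
Definition is_law (T : Type) (D : fdist R T) : Prop :=
  all (fun y => 0 < y.2) D /\ \sum_(y <- D) y.2 = 1.

Section Expectation.
Context (T U : Type).
Implicit Types (D : fdist R T) (f g : T -> R).

Lemma Ex_fret (x : T) f : Ex (fret R x) f = f x.
Proof. by rewrite /Ex big_seq1 mul1r. Qed.

Lemma Ex_fbind D (K : T -> fdist R U) (f : U -> R) :
  Ex (fbind D K) f = Ex D (fun x => Ex (K x) f).
Proof.
rewrite /Ex /fbind big_flatten /= big_map; apply: eq_bigr => x _.
by rewrite big_map mulr_sumr; apply: eq_bigr => y _; rewrite mulrA.
Qed.

Lemma eq_Ex D f g : f =1 g -> Ex D f = Ex D g.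
Proof. by move=> fg; apply: eq_bigr => x _; rewrite fg. Qed.

Lemma ExD D f g : Ex D (fun x => f x + g x) = Ex D f + Ex D g.
Proof. by rewrite /Ex -big_split; apply: eq_bigr => x _; rewrite mulrDr. Qed.

Lemma ExZ D f c : Ex D (fun x => c * f x) = c * Ex D f.
Proof. by rewrite /Ex mulr_sumr; apply: eq_bigr => x _; rewrite mulrCA. Qed.

Lemma ExM D f c : Ex D (fun x => f x * c) = Ex D f * c.
Proof. by rewrite /Ex mulr_suml; apply: eq_bigr => x _; rewrite mulrA. Qed.

Lemma ExN D f : Ex D (fun x => - f x) = - Ex D f.
Proof. by rewrite /Ex -sumrN; apply: eq_bigr => x _; rewrite mulrN. Qed.

Lemma ExB D f g : Ex D (fun x => f x - g x) = Ex D f - Ex D g.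
Proof. by rewrite (ExD D f (fun x => - g x)) ExN. Qed.

Lemma Ex_cst D c : is_law D -> Ex D (fun=> c) = c.
Proof. by case=> _ s1; rewrite /Ex -mulr_suml s1 mul1r. Qed.

Lemma Ex_sum (I : Type) (r : seq I) (P : pred I) D (F : I -> T -> R) :
  Ex D (fun x => \sum_(i <- r | P i) F i x) = \sum_(i <- r | P i) Ex D (F i).
Proof.
by rewrite /Ex exchange_big; apply: eq_bigr => x _; rewrite mulr_sumr.
Qed.

Lemma Ex_swap D (E : fdist R U) (f : T -> U -> R) :
  Ex D (fun x => Ex E (f x)) = Ex E (fun y => Ex D (f^~ y)).
Proof.
rewrite /Ex; under eq_bigr do rewrite mulr_sumr.
rewrite exchange_big; apply: eq_bigr => y _; rewrite mulr_sumr.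
by apply: eq_bigr => x _; rewrite mulrCA.
Qed.

Lemma law_fret (x : T) : is_law (fret R x).
Proof. by split; rewrite ?big_seq1//= ltr01. Qed.

End Expectation.

Lemma law_fbind (T U : eqType) (D : fdist R T) (K : T -> fdist R U) :
  is_law D -> (forall x, is_law (K x)) -> is_law (fbind D K).
Proof.
move=> lD lK; split.
  apply/allP => /= _ /flattenP[_ /mapP[x xD ->] /mapP[y yK ->]] /=.
  by rewrite mulr_gt0// ?(allP lD.1 x xD)// (allP (lK x.1).1 y yK).
transitivity (Ex (fbind D K) (fun=> 1)); first by under [RHS]eq_bigr do rewrite mulr1.
rewrite Ex_fbind -[RHS](Ex_cst 1 lD); apply: eq_Ex => x; exact: Ex_cst.
Qed.

Section Outcomes.
Context (T : eqType).
Implicit Types (D : fdist R T) (f g : T -> R).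

Definition outcomes D : seq T := [seq y.1 | y <- D].

Lemma mem_outcomes D y : y \in D -> y.1 \in outcomes D.
Proof. exact: (map_f (fun y => y.1)). Qed.

Lemma eq_in_Ex D f g : {in outcomes D, f =1 g} -> Ex D f = Ex D g.
Proof.
move=> fg; rewrite /Ex big_seq [RHS]big_seq; apply: eq_bigr => y yD.
by rewrite fg ?mem_outcomes.
Qed.

Lemma ler_Ex D f g : is_law D ->
  {in outcomes D, forall x, f x <= g x} -> Ex D f <= Ex D g.
Proof.
move=> lD fg; rewrite /Ex big_seq [leRHS]big_seq; apply: ler_sum => y yD.
by rewrite ler_wpM2l ?fg ?mem_outcomes// ltW// (allP lD.1).
Qed.

Lemma PrE D x : Pr D x = Ex D (fun y => (y == x)%:R).
Proof.
rewrite /Pr /Ex [LHS]big_mkcond; apply: eq_bigr => y _.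
by case: eqP; rewrite ?mulr1 ?mulr0.
Qed.

Lemma Pr_ge0 D x : is_law D -> 0 <= Pr D x.
Proof.
move=> lD; rewrite /Pr big_seq_cond; apply: sumr_ge0 => y /andP[yD _].
by rewrite ltW// (allP lD.1).
Qed.

Lemma Pr_gt0 D x : is_law D -> (0 < Pr D x) = (x \in outcomes D).
Proof.
move=> lD; apply/idP/idP => [|/mapP[y yD ->]].
  apply: contraTT => xD; rewrite /Pr big_seq_cond big_pred0 ?ltxx// => y.
  by apply/negP => /andP[yD /eqP yx]; rewrite -yx map_f in xD.
rewrite /Pr (big_rem y)//= eqxx ltr_pwDl ?(allP lD.1)// big_seq_cond.
apply: sumr_ge0 => z /andP[/mem_rem zD _]; by rewrite ltW// (allP lD.1).
Qed.

Lemma fsuppE D : is_law D -> fsupp D = undup (outcomes D).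
Proof.
move=> lD; rewrite /fsupp; congr undup; apply/all_filterP/allP => x xD.
by rewrite Pr_gt0.
Qed.

Lemma Ex_outcomes D f : Ex D f = \sum_(x <- undup (outcomes D)) Pr D x * f x.
Proof.
rewrite /Ex (sum_fibers _ (fun y => y.1)); apply: eq_bigr => x _.
by rewrite /Pr mulr_suml; apply: eq_bigr => y /eqP->.
Qed.

Lemma shannonE D : is_law D -> shannon D = Ex D (fun x => - ln (Pr D x)).
Proof.
by move=> lD; rewrite /shannon fsuppE// Ex_outcomes; apply: eq_bigr => x _; rewrite mulrN.
Qed.

Lemma sum_Pr D : is_law D -> \sum_(x <- undup (outcomes D)) Pr D x = 1.
Proof.
move=> lD; rewrite -[RHS](Ex_cst 1 lD) Ex_outcomes.
by apply: eq_bigr => x _; rewrite mulr1.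
Qed.

(** Gibbs' inequality. It is used with a code [q] that is easier to compute with
    than the law itself. *)
Lemma gibbs D (q : T -> R) : is_law D ->
  {in outcomes D, forall x, 0 < q x} ->
  \sum_(x <- undup (outcomes D)) q x <= 1 ->
  shannon D <= Ex D (fun x => - ln (q x)).
Proof.
move=> lD q0 q1; rewrite shannonE// !Ex_outcomes.
apply: (@le_trans _ _ (\sum_(x <- undup (outcomes D))
    (Pr D x * - ln (q x) + (q x - Pr D x)))).
  rewrite big_seq [leRHS]big_seq; apply: ler_sum => x; rewrite mem_undup => xD.
  by rewrite !mulrN entropy_term_le ?Pr_ge0 ?q0.
rewrite big_split/= sumrB (sum_Pr lD); lra.
Qed.

Lemma Pr_le_Ex D f x : is_law D -> (forall y, 0 <= f y) -> Pr D x * f x <= Ex D f.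
Proof.
move=> lD f0; rewrite PrE -ExM; apply: ler_Ex => // y _.
by case: eqP => [->|_]; rewrite ?mul1r ?mul0r.
Qed.

Lemma Pr_fret (x y : T) : Pr (fret R x) y = (x == y)%:R.
Proof. by rewrite PrE Ex_fret. Qed.

End Outcomes.

Lemma outcomes_fbind (T U : eqType) (D : fdist R T) (K : T -> fdist R U) z :
  reflect (exists2 x, x \in outcomes D & z \in outcomes (K x))
          (z \in outcomes (fbind D K)).
Proof.
apply: (iffP mapP) => [[_ /flattenP[_ /mapP[x xD ->] /mapP[y yK ->]] ->]|].
  by exists x.1; [exact: (mem_outcomes xD)|exact: (mem_outcomes yK)].
move=> [_ /mapP[x xD ->] /mapP[y yK ->]].
exists (y.1, x.2 * y.2) => //; apply/flattenP.
exists [seq (y.1, x.2 * y.2) | y <- K x.1]; apply/mapP; [by exists x|by exists y].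
Qed.

Lemma outcomes_fret (T : eqType) (x y : T) :
  (x \in outcomes (fret R y)) = (x == y).
Proof. by rewrite mem_seq1. Qed.

End FiniteLaws.

(** * The law of an iterated random substitution *)

Section Substitution.
Context (R : realType) (d : nat) (theta : random_substitution R d).
Local Notation letter := 'I_d.+1.
Local Notation word := (seq letter).
Implicit Types (a b : letter) (u v w : word) (f : word -> R).

Local Notation iterate k u := (subst_iter theta k u).

Lemma law_subst_letter a : is_law (subst_letter theta a).
Proof.
split; first by apply/allP => _ /mapP[j _ ->] /=; exact: rs_prob_gt0.
by rewrite /subst_letter big_map big_enum /= rs_prob_sum1.
Qed.

Lemma law_subst_word u : is_law (subst_word theta u).
Proof.
elim: u => [|a u IH] /=; first exact: law_fret.
apply: law_fbind => [|x]; first exact: law_subst_letter.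
by apply: law_fbind => // y; exact: law_fret.
Qed.

Lemma law_subst_iter k u : is_law (iterate k u).
Proof.
elim: k => [|k IH]; first exact: law_fret.
by apply: law_fbind => // x; exact: law_subst_word.
Qed.

Lemma Ex_subst_word_cons a u f :
  Ex (subst_word theta (a :: u)) f =
  Ex (subst_letter theta a) (fun x => Ex (subst_word theta u) (fun y => f (x ++ y))).
Proof.
rewrite /= Ex_fbind; apply: eq_Ex => x; rewrite Ex_fbind; apply: eq_Ex => y.
exact: Ex_fret.
Qed.

Lemma Ex_subst_word_cat u v f :
  Ex (subst_word theta (u ++ v)) f =
  Ex (subst_word theta u) (fun x => Ex (subst_word theta v) (fun y => f (x ++ y))).
Proof.
elim: u f => [|a u IH] f; first by rewrite /= Ex_fret.
rewrite cat_cons !Ex_subst_word_cons; apply: eq_Ex => x; rewrite IH.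
by apply: eq_Ex => y; apply: eq_Ex => z; rewrite catA.
Qed.

Lemma Ex_subst_iterS k u f :
  Ex (iterate k.+1 u) f = Ex (iterate k u) (fun v => Ex (subst_word theta v) f).
Proof. exact: Ex_fbind. Qed.

Lemma Ex_subst_iterD m k u f :
  Ex (iterate (m + k) u) f = Ex (iterate m u) (fun v => Ex (iterate k v) f).
Proof.
elim: k f => [|k IH] f.
  by rewrite addn0; apply: eq_Ex => v; rewrite Ex_fret.
by rewrite addnS Ex_subst_iterS IH; apply: eq_Ex => v; rewrite Ex_subst_iterS.
Qed.

(** The letters of a word evolve independently, at all times. *)
Lemma Ex_subst_iter_cat k u v f :
  Ex (iterate k (u ++ v)) f =
  Ex (iterate k u) (fun x => Ex (iterate k v) (fun y => f (x ++ y))).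
Proof.
elim: k f => [|k IH] f; first by rewrite !Ex_fret.
rewrite !Ex_subst_iterS IH; apply: eq_Ex => x.
under eq_Ex do rewrite Ex_subst_word_cat.
by rewrite Ex_swap; apply: eq_Ex => y; rewrite Ex_subst_iterS.
Qed.

Lemma Ex_subst_iter_nil k f : Ex (iterate k [::]) f = f [::].
Proof. by elim: k f => [|k IH] f; rewrite ?Ex_subst_iterS ?IH Ex_fret. Qed.

Lemma Ex_subst_iter_sum k u (f : letter -> R) :
  Ex (iterate k u) (fun w => \sum_(b <- w) f b)
    = \sum_(a <- u) Ex (iterate k [:: a]) (fun w => \sum_(b <- w) f b).
Proof.
elim: u => [|a u IH]; first by rewrite Ex_subst_iter_nil !big_nil.
rewrite big_cons -IH (Ex_subst_iter_cat k [:: a] u).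
transitivity (Ex (iterate k [:: a]) (fun x => \sum_(b <- x) f b +
    Ex (iterate k u) (fun w => \sum_(b <- w) f b))); last first.
  by rewrite ExD Ex_cst//; exact: law_subst_iter.
apply: eq_Ex => x; rewrite -[X in X + _](Ex_cst _ (law_subst_iter k u)) -ExD.
by apply: eq_Ex => y; rewrite big_cat.
Qed.

Lemma size_subst_word u w : w \in outcomes (subst_word theta u) ->
  (size u <= size w)%N.
Proof.
elim: u w => [|a u IH] w //= /outcomes_fbind[x xa /outcomes_fbind[y yu]].
rewrite outcomes_fret => /eqP ->; rewrite size_cat -addn1 addnC leq_add ?IH//.
case/mapP: xa => _ /mapP[j _ ->] -> /=; rewrite lt0n size_eq0.
exact: rs_image_neq0.
Qed.

Lemma size_subst_iter k u w : w \in outcomes (iterate k u) ->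
  (size u <= size w)%N.
Proof.
elim: k w => [|k IH] w; first by rewrite outcomes_fret => /eqP->.
by move=> /outcomes_fbind[v /IH uv /size_subst_word]; exact: leq_trans.
Qed.

(** The images of the individual letters of [u] under the [k]-th iterate, kept
    apart. Forgetting where the images are cut yields the [k]-th iterate of
    [u], while the entropy of the uncut list is a plain sum over letters. *)
Fixpoint blocks k u : fdist R (seq word) :=
  if u is a :: u' then
    fbind (iterate k [:: a]) (fun x =>
      fbind (blocks k u') (fun xs => fret R (x :: xs)))
  else fret R [::].

Lemma law_blocks k u : is_law (blocks k u).
Proof.
elim: u => [|a u IH] /=; first exact: law_fret.
apply: law_fbind => [|x]; first exact: law_subst_iter.
by apply: law_fbind => // y; exact: law_fret.
Qed.

Lemma Ex_blocks_cons k a u (f : seq word -> R) : Ex (blocks k (a :: u)) f =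
  Ex (iterate k [:: a]) (fun x => Ex (blocks k u) (fun xs => f (x :: xs))).
Proof.
rewrite /= Ex_fbind; apply: eq_Ex => x; rewrite Ex_fbind; apply: eq_Ex => xs.
exact: Ex_fret.
Qed.

Lemma Ex_blocks_flatten k u f :
  Ex (iterate k u) f = Ex (blocks k u) (f \o flatten).
Proof.
elim: u f => [|a u IH] f; first by rewrite Ex_subst_iter_nil /= Ex_fret.
rewrite (Ex_subst_iter_cat k [:: a] u) Ex_blocks_cons; apply: eq_Ex => x.
by rewrite IH.
Qed.

Lemma Ex_blocks_sum k u f :
  Ex (blocks k u) (fun xs => \sum_(x <- xs) f x)
    = \sum_(a <- u) Ex (iterate k [:: a]) f.
Proof.
elim: u => [|a u IH]; first by rewrite /= Ex_fret !big_nil.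
rewrite big_cons -IH Ex_blocks_cons.
transitivity (Ex (iterate k [:: a]) (fun x => f x +
    Ex (blocks k u) (fun xs => \sum_(x <- xs) f x))); last first.
  by rewrite ExD Ex_cst//; exact: law_subst_iter.
apply: eq_Ex => x; rewrite -[X in X + _](Ex_cst _ (law_blocks k u)) -ExD.
by apply: eq_Ex => y; rewrite big_cons.
Qed.

Lemma outcomes_blocks_cons k a u xs : xs \in outcomes (blocks k (a :: u)) ->
  exists x ys, [/\ xs = x :: ys, x \in outcomes (iterate k [:: a])
    & ys \in outcomes (blocks k u)].
Proof.
move=> /outcomes_fbind[x xa /outcomes_fbind[ys yu]].
by rewrite outcomes_fret => /eqP ->; exists x, ys.
Qed.

Lemma size_blocks k u xs : xs \in outcomes (blocks k u) -> size xs = size u.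
Proof.
elim: u xs => [|a u IH] xs; first by rewrite outcomes_fret => /eqP->.
by move=> /outcomes_blocks_cons[x [ys [-> _ /IH]]] /= ->.
Qed.

Lemma mem_blocks k u xs x : xs \in outcomes (blocks k u) -> x \in xs ->
  exists2 a, a \in u & x \in outcomes (iterate k [:: a]).
Proof.
elim: u xs => [|a u IH] xs; first by rewrite outcomes_fret => /eqP->.
move=> /outcomes_blocks_cons[y [ys [-> ya /IH{}IH]]].
rewrite inE => /predU1P[->|/IH[b bu xb]]; first by exists a; rewrite ?mem_head.
by exists b => //; rewrite inE bu orbT.
Qed.

Lemma block_neq0 k u xs x : xs \in outcomes (blocks k u) -> x \in xs ->
  x != [::].
Proof.
by move=> xsu /(mem_blocks xsu)[a _ /size_subst_iter]; rewrite -size_eq0 -lt0n.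
Qed.

Lemma outcomes_flatten k u xs : xs \in outcomes (blocks k u) ->
  flatten xs \in outcomes (iterate k u).
Proof.
move=> xsu; rewrite -Pr_gt0; last exact: law_subst_iter.
rewrite PrE Ex_blocks_flatten.
apply: (@lt_le_trans _ _ (Pr (blocks k u) xs)); first by rewrite Pr_gt0//; exact: law_blocks.
rewrite PrE; apply: ler_Ex => [|ys _]; first exact: law_blocks.
by case: eqP => [->|_] /=; rewrite ?eqxx.
Qed.

(** The blocks are independent, so their entropies add. *)
Lemma shannon_blocks k u :
  shannon (blocks k u) = \sum_(a <- u) shannon (iterate k [:: a]).
Proof.
elim: u => [|a u IH].
  by rewrite big_nil shannonE ?Ex_fret ?Pr_fret ?eqxx ?ln1 ?oppr0//; exact: law_fret.
have la := law_subst_iter k [:: a]; have lu := law_blocks k u.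
rewrite big_cons -IH !shannonE//; last exact: law_blocks.
have Prc x xs : Pr (blocks k (a :: u)) (x :: xs) =
    Pr (iterate k [:: a]) x * Pr (blocks k u) xs.
  rewrite !PrE Ex_blocks_cons -ExM; apply: eq_Ex => y.
  by rewrite -ExZ; apply: eq_Ex => ys; rewrite eqseq_cons -natrM mulnb.
rewrite Ex_blocks_cons.
rewrite -[X in _ + X](Ex_cst _ la) -ExD; apply: eq_in_Ex => x xa.
rewrite -[X in X + _](Ex_cst _ lu) -ExD; apply: eq_in_Ex => xs xu.
by rewrite Prc lnM ?opprD// posrE Pr_gt0.
Qed.

(** Revealing the image of [u] and its cut points together costs no less than
    revealing the image alone. *)
Lemma shannon_subst_iter_le k u :
  shannon (iterate k u) <= \sum_(a <- u) shannon (iterate k [:: a]).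
Proof.
have lu := law_blocks k u.
rewrite -shannon_blocks !shannonE//; last exact: law_subst_iter.
rewrite Ex_blocks_flatten; apply: ler_Ex => // xs xsu /=.
have lku := law_subst_iter k u; have xsk := outcomes_flatten xsu.
rewrite lerN2 ler_ln ?posrE ?Pr_gt0// !PrE Ex_blocks_flatten; apply: ler_Ex => // ys _.
by case: eqP => [->|_] /=; rewrite ?eqxx.
Qed.

Lemma Pr_subst_iterD_ge m k u v w :
  Pr (iterate m u) v * Pr (iterate k v) w <= Pr (iterate (m + k) u) w.
Proof.
rewrite [leRHS]PrE Ex_subst_iterD; under [leRHS]eq_Ex do rewrite -PrE.
apply: (Pr_le_Ex (f := fun v => Pr (iterate k v) w)).
  exact: law_subst_iter.
by move=> y; apply: Pr_ge0; exact: law_subst_iter.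
Qed.

Lemma outcomes_subst_iterD m k u v w : v \in outcomes (iterate m u) ->
  w \in outcomes (iterate k v) -> w \in outcomes (iterate (m + k) u).
Proof.
have [lm lk lmk] := And3 (law_subst_iter m u) (law_subst_iter k v) (law_subst_iter (m + k) u).
rewrite -!Pr_gt0// => pv pw; apply: lt_le_trans (Pr_subst_iterD_ge m k u v w).
exact: mulr_gt0.
Qed.

(** The pair of the words at times [m] and [m + k] has the entropy on the right,
    and determines the later word. *)
Lemma shannon_subst_iterD m k u : shannon (iterate (m + k) u) <=
  shannon (iterate m u) + Ex (iterate m u) (fun v => shannon (iterate k v)).
Proof.
rewrite !shannonE ?Ex_subst_iterD -?ExD; try exact: law_subst_iter.
apply: ler_Ex => [|v vu]; first exact: law_subst_iter.
rewrite shannonE; last exact: law_subst_iter.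
rewrite -(Ex_cst (- ln (Pr (iterate m u) v)) (law_subst_iter k v)) -ExD.
apply: ler_Ex => [|w wv]; first exact: law_subst_iter.
have pv : 0 < Pr (iterate m u) v by rewrite Pr_gt0//; exact: law_subst_iter.
have pw : 0 < Pr (iterate k v) w by rewrite Pr_gt0//; exact: law_subst_iter.
rewrite -opprD -lnM ?posrE// lerN2.
have le := Pr_subst_iterD_ge m k u v w.
by rewrite ler_ln ?posrE ?mulr_gt0// (lt_le_trans _ le) ?mulr_gt0.
Qed.

End Substitution.

(** * Sums over words of a given length *)

Lemma occ_cons d a (v w : seq 'I_d.+1) :
  occ v (a :: w) = (prefix v (a :: w) + occ v w)%N.
Proof.
rewrite /occ /=; congr (_ + _)%N.
by rewrite (iotaDl 1 0) count_map; apply: eq_count => i.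
Qed.

Lemma occ_letter d (a : 'I_d.+1) w : occ [:: a] w = count_mem a w.
Proof.
elim: w => [|b w IH] //=; rewrite occ_cons IH /= prefix0s andbT.
by rewrite eq_sym.
Qed.

Lemma occ_nil d (w : seq 'I_d.+1) : occ [::] w = size w.
Proof. by elim: w => [|b w IH] //; rewrite occ_cons IH prefix0s. Qed.

(** Every occurrence of [v], except one at the start of the word, extends to
    the left in exactly one way. The last term is the occurrence of the empty
    word after the last letter, which [occ] does not count. *)
Lemma sum_occ_cons d (v w : seq 'I_d.+1) :
  (\sum_(a : 'I_d.+1) occ (a :: v) w + prefix v w = occ v w + (v == [::]))%N.
Proof.
elim: w => [|b w IH].
  by rewrite big1 => [|a _]; [case: v|].
have -> : (\sum_a occ (a :: v) (b :: w) = prefix v w + \sum_(a : 'I_d.+1) occ (a :: v) w)%N.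
  under eq_bigr do rewrite occ_cons.
  rewrite big_split/=; congr (_ + _)%N.
  rewrite (bigD1 b)//= eqxx big1 ?addn0// => a ab.
  by rewrite /= (negPf ab).
by rewrite [in RHS]occ_cons; lia.
Qed.

Section WordSum.
Context (R : realType) (d : nat).
Local Notation letter := 'I_d.+1.
Local Notation word := (seq letter).
Implicit Types (a : letter) (u v w : word) (f g : word -> R).

(** Recursion on the first letter, instead of a sum over tuples, matches the way
    in which codes for words are defined and normalised. *)
Fixpoint word_sum (n : nat) f : R :=
  if n is n'.+1 then \sum_a word_sum n' (fun w => f (a :: w)) else f [::].

Lemma sum_tupleE n f : \sum_(u : n.-tuple letter) f u = word_sum n f.
Proof.
elim: n f => [|n IH] f /=.
  rewrite (bigD1 [tuple])//= big1 ?addr0// => t.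
  by rewrite (tuple0 t).
transitivity (\sum_a \sum_(t : n.-tuple letter) f (a :: t)).
  rewrite pair_big/=.
  rewrite (reindex (fun p : letter * n.-tuple letter => [tuple of p.1 :: p.2]))//=.
  exists (fun t => (thead t, [tuple of behead t])) => [[a t] _|t _] /=.
    by congr (_, _); apply: val_inj.
  by rewrite [RHS]tuple_eta.
by apply: eq_bigr => a _; rewrite -IH.
Qed.

Lemma eq_word_sum n f g : (forall w, size w = n -> f w = g w) ->
  word_sum n f = word_sum n g.
Proof.
elim: n f g => [|n IH] f g fg /=; first exact: fg.
by apply: eq_bigr => a _; apply: IH => w wn; rewrite fg//= wn.
Qed.

Lemma ler_word_sum n f g : (forall w, size w = n -> f w <= g w) ->
  word_sum n f <= word_sum n g.
Proof.
elim: n f g => [|n IH] f g fg /=; first exact: fg.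
by apply: ler_sum => a _; apply: IH => w wn; rewrite fg//= wn.
Qed.

Lemma word_sumD n f g :
  word_sum n (fun w => f w + g w) = word_sum n f + word_sum n g.
Proof.
elim: n f g => [|n IH] f g //=; rewrite -big_split/=.
by apply: eq_bigr => a _; rewrite IH.
Qed.

Lemma word_sumZ n c f : word_sum n (fun w => c * f w) = c * word_sum n f.
Proof.
elim: n f => [|n IH] f //=; rewrite mulr_sumr.
by apply: eq_bigr => a _; rewrite IH.
Qed.

Lemma word_sumN n f : word_sum n (fun w => - f w) = - word_sum n f.
Proof.
by rewrite -mulN1r -word_sumZ; apply: eq_word_sum => w _; rewrite mulN1r.
Qed.

Lemma word_sumB n f g :
  word_sum n (fun w => f w - g w) = word_sum n f - word_sum n g.
Proof. by rewrite (word_sumD n f (fun w => - g w)) word_sumN. Qed.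

Lemma word_sum_cst n c : word_sum n (fun=> c) = d.+1%:R ^+ n * c.
Proof.
elim: n => [|n IH] /=; first by rewrite mul1r.
by rewrite IH sumr_const card_ord exprS -mulrA mulr_natl.
Qed.

Lemma word_sum_big n (I : Type) (r : seq I) (F : I -> word -> R) :
  word_sum n (fun w => \sum_(i <- r) F i w) = \sum_(i <- r) word_sum n (F i).
Proof.
elim: r => [|i r IH].
  rewrite big_nil -[RHS](mulr0 (d.+1%:R ^+ n)) -word_sum_cst.
  by apply: eq_word_sum => w _; rewrite big_nil.
rewrite big_cons -IH -word_sumD.
by apply: eq_word_sum => w _; rewrite big_cons.
Qed.

Lemma word_sum_Ex n (T : Type) (D : fdist R T) (F : T -> word -> R) :
  word_sum n (fun w => Ex D (F^~ w)) = Ex D (fun x => word_sum n (F x)).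
Proof.
rewrite /Ex word_sum_big; apply: eq_bigr => x _; exact: word_sumZ.
Qed.

Lemma word_sum_ge0 n f : (forall w, 0 <= f w) -> 0 <= word_sum n f.
Proof.
by elim: n f => [|n IH] f f0 /=; [exact: f0|apply: sumr_ge0 => a _; exact: IH].
Qed.

Lemma ler_term_word_sum w f : (forall v, 0 <= f v) -> f w <= word_sum (size w) f.
Proof.
elim: w f => [|a w IH] f f0 //=.
rewrite (bigD1 a)//= -[leLHS]addr0; apply: lerD; first exact: (IH (fun w => f (a :: w))).
by apply: sumr_ge0 => b _; exact: word_sum_ge0.
Qed.

Lemma word_sum_cat i j (F : word -> word -> R) :
  word_sum (i + j) (fun w => F (take i w) (drop i w)) =
  word_sum i (fun x => word_sum j (F x)).
Proof.
elim: i F => [|i IH] F /=.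
  by apply: eq_word_sum => w _; rewrite take0 drop0.
by apply: eq_bigr => a _; rewrite (IH (fun x => F (a :: x))).
Qed.

Lemma word_sum_pred1 n x f :
  word_sum n (fun w => (w == x)%:R * f w) = (size x == n)%:R * f x.
Proof.
elim: n x f => [|n IH] [|b x] f /=; rewrite ?mul0r//.
  rewrite big1// => a _.
  by rewrite -[RHS](mul0r (word_sum n (fun w => f (a :: w)))) -word_sumZ.
rewrite (bigD1 b)//= big1 ?addr0 => [|a ab].
  rewrite eqSS -(IH x (fun w => f (b :: w))); apply: eq_word_sum => w _.
  by rewrite eqseq_cons eqxx.
rewrite -[RHS](mul0r (word_sum n (fun w => f (a :: w)))) -word_sumZ.
by apply: eq_word_sum => w _; rewrite eqseq_cons (negPf ab).
Qed.

Lemma word_sum_prefix n w f :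
  word_sum n (fun v => (prefix v w)%:R * f v)
    = if (n <= size w)%N then f (take n w) else 0.
Proof.
case: leqP => nw.
  have := word_sum_pred1 n (take n w) f; rewrite size_takel// eqxx mul1r => <-.
  by apply: eq_word_sum => v vn; rewrite prefixE vn eq_sym.
rewrite -[RHS](mul0r (word_sum n f)) -word_sumZ.
apply: eq_word_sum => v vn; case: (boolP (prefix v w)) => // /size_prefix.
by rewrite vn leqNgt nw.
Qed.

Lemma word_sum_occ_cons n a w f :
  word_sum n (fun v => (occ v (a :: w))%:R * f v) =
  (if (n <= (size w).+1)%N then f (take n (a :: w)) else 0)
    + word_sum n (fun v => (occ v w)%:R * f v).
Proof.
rewrite -[X in X + _](word_sum_prefix n (a :: w) f) -word_sumD.
by apply: eq_word_sum => v _; rewrite occ_cons natrD mulrDl.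
Qed.

Lemma word_sum_Pr n (D : fdist R word) :
  word_sum n (Pr D) = Ex D (fun w => (size w == n)%:R).
Proof.
transitivity (word_sum n (fun v => Ex D (fun w => (v == w)%:R * 1))).
  by apply: eq_word_sum => v _; rewrite PrE; apply: eq_Ex => w; rewrite eq_sym mulr1.
by rewrite word_sum_Ex; apply: eq_Ex => w; rewrite word_sum_pred1 mulr1.
Qed.

Lemma sum_words_le (S : seq word) f N : uniq S -> (forall w, 0 <= f w) ->
  {in S, forall w, (size w < N)%N} ->
  \sum_(w <- S) f w <= \sum_(n < N) word_sum n f.
Proof.
move=> uS f0 SN.
have -> : \sum_(w <- S) f w = \sum_(n < N) word_sum n (fun w => (w \in S)%:R * f w).
  transitivity (\sum_(w <- S) \sum_(n < N) (size w == n)%:R * f w).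
    rewrite big_seq [RHS]big_seq; apply: eq_bigr => w /SN wN.
    rewrite (bigD1 (Ordinal wN))//= eqxx mul1r big1 ?addr0// => i iw.
    rewrite -[size w]/(nat_of_ord (Ordinal wN)) (inj_eq val_inj) eq_sym.
    by rewrite (negPf iw) mul0r.
  rewrite exchange_big; apply: eq_bigr => n _.
  under eq_bigr do rewrite -word_sum_pred1.
  rewrite -word_sum_big; apply: eq_word_sum => w _; rewrite -mulr_suml; congr (_ * _).
  rewrite -natr_sum; congr (_%:R); rewrite -(count_uniq_mem _ uS) -sum1_count.
  by rewrite [RHS]big_mkcond; apply: eq_bigr => x _; rewrite /= eq_sym; case: eqP.
apply: ler_sum => n _; apply: ler_word_sum => w _.
by case: (w \in S); rewrite ?mul1r ?mul0r.
Qed.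

End WordSum.

(** * Cutting words into blocks *)

Section Parsings.
Context (T : eqType).
Implicit Types (w : seq T) (xs : seq (seq T)).

Fixpoint parsings_fuel (n : nat) w : seq (seq (seq T)) :=
  if n is n'.+1 then
    if w is [::] then [:: [::]] else
      [seq take i w :: xs | i <- index_iota 1 (size w).+1,
                            xs <- parsings_fuel n' (drop i w)]
  else [:: [::]].

(** The factorisations of a word into nonempty blocks. The recursion on the rest
    of the word after its first block is not structural; the length of the word
    is enough fuel. *)
Definition parsings w := parsings_fuel (size w) w.

Lemma parsings_fuelS n w : w != [::] -> parsings_fuel n.+1 w =
  flatten [seq [seq take i w :: xs | xs <- parsings_fuel n (drop i w)]
          | i <- index_iota 1 (size w).+1].
Proof. by case: w. Qed.

Lemma parsings_fuelE n w : (size w <= n)%N -> parsings_fuel n w = parsings w.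
Proof.
rewrite /parsings; have [m] := ubnP (size w).
elim: m n w => // m IH n w; have [->|w0] := eqVneq w [::]; first by case: n.
have s0 : (0 < size w)%N by rewrite lt0n size_eq0.
case: n => [|n]; first by move=> _; rewrite leqNgt s0.
rewrite -(prednK s0) !ltnS => wm wn; rewrite !parsings_fuelS//; congr (flatten _).
apply/eq_in_map => i; rewrite mem_index_iota => /andP[i0 _].
have dw : (size (drop i w) <= (size w).-1)%N by rewrite size_drop; lia.
by congr map; rewrite IH ?(leq_trans dw)// ?(leq_ltn_trans dw)// [RHS]IH// (leq_ltn_trans dw).
Qed.

Lemma parsingsE w : w != [::] ->
  parsings w = [seq take i w :: xs | i <- index_iota 1 (size w).+1,
                                     xs <- parsings (drop i w)].
Proof.
move=> w0; have s0 : (0 < size w)%N by rewrite lt0n size_eq0.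
rewrite {1}/parsings -{1}(prednK s0) parsings_fuelS//; congr (flatten _).
apply/eq_in_map => i; rewrite mem_index_iota => /andP[i0 _].
by rewrite parsings_fuelE// size_drop; lia.
Qed.

Lemma mem_parsings xs : all (predC1 [::]) xs -> xs \in parsings (flatten xs).
Proof.
elim: xs => [|x xs IH] //= /andP[x0 xs0].
have s0 : (0 < size x)%N by rewrite lt0n size_eq0.
rewrite parsingsE; last by rewrite -size_eq0 size_cat -lt0n addn_gt0 s0.
apply/allpairsPdep; exists (size x), xs; rewrite take_size_cat// drop_size_cat//.
by rewrite mem_index_iota ltnS size_cat leq_addr s0 IH.
Qed.

Section ParseSum.
Context (R : realType) (g : seq T -> R).

(** If blocks are drawn independently with law [g] and concatenated forever, this
    is the probability of reading [w] and having a cut right after it. *)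
Definition parse_sum w : R := \sum_(xs <- parsings w) \prod_(x <- xs) g x.

Lemma parse_sum_nil : parse_sum [::] = 1.
Proof. by rewrite /parse_sum big_seq1 big_nil. Qed.

Lemma parse_sumE w : w != [::] -> parse_sum w =
  \sum_(1 <= i < (size w).+1) g (take i w) * parse_sum (drop i w).
Proof.
move=> w0; rewrite /parse_sum parsingsE// big_allpairs_dep/=.
apply: eq_bigr => i _; rewrite mulr_sumr; apply: eq_bigr => xs _.
by rewrite big_cons.
Qed.

Hypothesis g0 : forall x, 0 <= g x.

Lemma parse_sum_ge0 w : 0 <= parse_sum w.
Proof. by apply: sumr_ge0 => xs _; apply: prodr_ge0. Qed.

(** The parsings of [x ++ w] that start with the block [x]. *)
Lemma parse_sum_cat x w : x != [::] ->
  g x * parse_sum w <= parse_sum (x ++ w).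
Proof.
move=> x0; have s0 : (0 < size x)%N by rewrite lt0n size_eq0.
have xw0 : x ++ w != [::] by rewrite -size_eq0 size_cat -lt0n addn_gt0 s0.
rewrite (parse_sumE xw0) -[leLHS]addr0.
rewrite (bigD1_seq (size x)) ?iota_uniq ?mem_index_iota ?ltnS ?size_cat ?leq_addr ?s0//=.
rewrite take_size_cat// drop_size_cat// lerD2l sumr_ge0// => i _.
by rewrite mulr_ge0 ?parse_sum_ge0.
Qed.

(** Distinct lists of nonempty blocks with the same concatenation are distinct
    parsings of it. *)
Lemma sum_same_flatten_le (S : seq (seq (seq T))) w : uniq S ->
  {in S, forall xs, all (predC1 [::]) xs} ->
  \sum_(xs <- S | flatten xs == w) \prod_(x <- xs) g x <= parse_sum w.
Proof.
move=> uS S0; rewrite -big_filter; apply: ler_sum_subset.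
- exact: filter_uniq.
- by move=> xs; rewrite mem_filter => /andP[/eqP<- /S0]; exact: mem_parsings.
- by move=> xs; exact: prodr_ge0.
Qed.

(** By induction on the length: the first block carries a total weight of at most
    1, and the rest of the word is a smaller instance. *)
Lemma parse_sum_le1 w : (forall v, v != [::] ->
    \sum_(1 <= i < (size v).+1) g (take i v) <= 1) ->
  parse_sum w <= 1.
Proof.
move=> g1; have [n] := ubnP (size w); elim: n w => // n IH w wn.
have [->|w0] := eqVneq w [::]; first by rewrite parse_sum_nil.
rewrite parse_sumE// (le_trans _ (g1 w w0))// !big_nat; apply: ler_sum => i /andP[i0 _].
rewrite ler_piMr// IH// size_drop.
by have : (0 < size w)%N by [rewrite lt0n size_eq0]; lia.
Qed.

End ParseSum.
End Parsings.

Section RenewalMass.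
Context (R : realType) (d : nat) (g : seq 'I_d.+1 -> R).
Hypothesis g0 : forall x, 0 <= g x.
Hypothesis g1 : forall n, \sum_(1 <= i < n.+1) word_sum i g <= 1.

(** The first block of a parsing is drawn with subprobability weights [g], and
    the rest of the word is a shorter instance of the same sum. *)
Lemma word_sum_parse_sum n : word_sum n (parse_sum g) <= 1.
Proof.
have [m] := ubnP n; elim: m n => // m IH [|n] nm; first by rewrite /= parse_sum_nil.
apply: le_trans (g1 n.+1).
have -> : word_sum n.+1 (parse_sum g) = \sum_(1 <= i < n.+2)
    word_sum n.+1 (fun w => g (take i w) * parse_sum g (drop i w)).
  rewrite -word_sum_big; apply: eq_word_sum => w wn.
  by rewrite parse_sumE ?wn// -size_eq0 wn.
rewrite !big_nat; apply: ler_sum => i /andP[i0 ile].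
rewrite -(subnKC (ile : (i <= n.+1)%N)).
rewrite (word_sum_cat i (n.+1 - i) (fun x y => g x * parse_sum g y)).
apply: ler_word_sum => x _; rewrite word_sumZ ler_piMr// IH//.
by lia.
Qed.


End RenewalMass.

(** * Entropy of a subdivided word *)

Lemma sum_geometric (R : realType) (r : R) n :
  \sum_(i < n) (1 - r) * r ^+ i = 1 - r ^+ n.
Proof.
elim: n => [|n IH]; first by rewrite big_ord0 expr0 subrr.
by rewrite big_ord_recr /= IH exprS; ring.
Qed.

Lemma sum_geometric_le1 (R : realType) (r : R) n : 0 <= r ->
  \sum_(i < n) (1 - r) * r ^+ i <= 1.
Proof. by move=> r0; rewrite sum_geometric gerBl exprn_ge0. Qed.

Lemma sum_Pr_le1 (R : realType) (T : eqType) (D : fdist R T) (S : seq T) :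
  is_law D -> uniq S -> \sum_(x <- S) Pr D x <= 1.
Proof.
move=> lD uS; under eq_bigr do rewrite PrE.
rewrite -Ex_sum -[leRHS](Ex_cst 1 lD); apply: ler_Ex => // y _.
have [yS|yS] := boolP (y \in S).
  rewrite (bigD1_seq y)//= eqxx big1 ?addr0// => x; rewrite eq_sym.
  by case: eqP.
rewrite big_seq big1 ?ler01// => x xS; case: eqP => // yx.
by rewrite yx xS in yS.
Qed.

Section CutPoints.
Context (R : realType) (d : nat) (theta : random_substitution R d).
Local Notation word := (seq 'I_d.+1).
Variables (k : nat) (u : word) (D : fdist R word) (q : R).
Hypothesis lD : is_law D.
Hypothesis uD : {subset outcomes (subst_iter theta k u) <= outcomes D}.
Hypothesis q01 : 0 < q < 1.

(** The probability that, in a sequence of independent cuts of probability [q],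
    the gap after a cut has the length of [x]. *)
Let cut_weight (x : word) := q * (1 - q) ^+ (size x).-1.

Let cut_weight_gt0 x : 0 < cut_weight x.
Proof.
by case/andP: q01 => q0 q1; rewrite mulr_gt0// exprn_gt0// subr_gt0.
Qed.

Let parse_sum_cut_weight_le1 w : parse_sum cut_weight w <= 1.
Proof.
apply: parse_sum_le1 => [x|v _]; first exact: ltW.
have q1 : 0 <= 1 - q by case/andP: q01 => _ /ltW; rewrite subr_ge0.
apply: le_trans (sum_geometric_le1 (size v) q1).
rewrite big_add1 /= big_mkord; apply: ler_sum => i _.
by rewrite /cut_weight size_takel//= opprB addrCA subrr addr0.
Qed.

Let ln_prod_cut_weight (xs : seq word) : all (predC1 [::]) xs ->
  ln (\prod_(x <- xs) cut_weight x) = (size xs)%:R * ln q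
    + ((size (flatten xs))%:R - (size xs)%:R) * ln (1 - q).
Proof.
have [q0 q1] : 0 < q /\ 0 < 1 - q by case/andP: q01 => ->; rewrite subr_gt0.
elim: xs => [|x xs IH] /=; first by rewrite big_nil ln1 => _; ring.
move=> /andP[x0 /IH{}IH]; rewrite big_cons lnM ?posrE ?cut_weight_gt0//; last first.
  by apply: prodr_gt0 => y _.
rewrite IH /cut_weight lnM ?posrE ?exprn_gt0// lnXn// size_cat natrD.
have sx : (size x)%:R = (size x).-1%:R + 1 :> R.
  by rewrite natr1 prednK// lt0n size_eq0.
by rewrite sx -[(size xs).+1%:R]natr1 -[_ *+ (size x).-1]mulr_natr; ring.
Qed.

(** Given the word [w] drawn from [D], a list of blocks concatenating to [w]
    is described by marking each position of [w] as a cut with probability [q],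
    independently. Gibbs' inequality for this code is linear in the number of
    blocks and in the length of [w], so only their means matter. *)
Lemma shannon_cut_points :
  \sum_(a <- u) shannon (subst_iter theta k [:: a]) <=
  Ex (subst_iter theta k u) (fun w => - ln (Pr D w)
    - (size u)%:R * ln q - ((size w)%:R - (size u)%:R) * ln (1 - q)).
Proof.
have lu := law_blocks theta k u.
have blocks0 : {in outcomes (blocks theta k u), forall xs, all (predC1 [::]) xs}.
  by move=> xs xsu; apply/allP => x xxs; exact: block_neq0 xsu xxs.
pose code (xs : seq word) := Pr D (flatten xs) * \prod_(x <- xs) cut_weight x.
have prod0 (xs : seq word) : 0 < \prod_(x <- xs) cut_weight x by apply: prodr_gt0.
have PrD0 : {in outcomes (blocks theta k u), forall xs, 0 < Pr D (flatten xs)}.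
  by move=> xs /outcomes_flatten/uD; rewrite -Pr_gt0.
have code0 : {in outcomes (blocks theta k u), forall xs, 0 < code xs}.
  by move=> xs xsu; rewrite mulr_gt0// PrD0.
rewrite -shannon_blocks; apply: le_trans (gibbs lu code0 _) _.
  (* Grouping the lists of blocks by their concatenation [w], the inner sum is
     over distinct parsings of [w]. *)
  rewrite (sum_fibers _ flatten).
  apply: le_trans (sum_Pr_le1 lD (undup_uniq
    [seq flatten i | i <- undup (outcomes (blocks theta k u))])).
  apply: ler_sum => w _.
  rewrite (eq_bigr (fun xs => Pr D w * \prod_(x <- xs) cut_weight x)); last first.
    by move=> xs /eqP <-.
  rewrite -mulr_sumr ler_piMr ?Pr_ge0//.
  apply: le_trans (parse_sum_cut_weight_le1 w).
  apply: sum_same_flatten_le; [by move=> x; exact: ltW|exact: undup_uniq|].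
  by move=> xs; rewrite mem_undup; exact: blocks0.
rewrite Ex_blocks_flatten; apply: ler_Ex => // xs xsu.
rewrite /code lnM ?posrE ?PrD0// ln_prod_cut_weight ?blocks0//= (size_blocks xsu).
by rewrite !opprD !addrA.
Qed.

End CutPoints.

(** * Averages over the Perron--Frobenius eigenvector *)

Section PFAverages.
Context (R : realType) (d : nat) (theta : random_substitution R d).
Context (lambda : R) (Rvec : 'cV[R]_d.+1).
Local Notation letter := 'I_d.+1.
Local Notation word := (seq letter).
Local Notation iterate k u := (subst_iter theta k u).
Implicit Types (f g : word -> R).

Hypothesis eigenR : subst_matrix theta *m Rvec = lambda *: Rvec.
Hypothesis Rvec_gt0 : forall a, 0 < Rvec a 0.
Hypothesis Rvec_sum : \sum_a Rvec a 0 = 1.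

(** The chain is started at a random letter of law [Rvec]. *)
Definition pf_mean m f : R := \sum_a Rvec a 0 * Ex (iterate m [:: a]) f.

Definition pf_entropy m : R := \sum_a Rvec a 0 * shannon (iterate m [:: a]).

Lemma pf_meanD m f g : pf_mean m (fun w => f w + g w) = pf_mean m f + pf_mean m g.
Proof. by rewrite -big_split/=; apply: eq_bigr => a _; rewrite ExD mulrDr. Qed.

Lemma pf_meanZ m c f : pf_mean m (fun w => c * f w) = c * pf_mean m f.
Proof. by rewrite mulr_sumr; apply: eq_bigr => a _; rewrite ExZ mulrCA. Qed.

Lemma pf_mean_cst m c : pf_mean m (fun=> c) = c.
Proof.
rewrite -[RHS]mul1r -Rvec_sum mulr_suml; apply: eq_bigr => a _.
by rewrite Ex_cst//; exact: law_subst_iter.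
Qed.

Lemma ler_pf_mean m f g :
  (forall a, {in outcomes (iterate m [:: a]), forall w, f w <= g w}) ->
  pf_mean m f <= pf_mean m g.
Proof.
move=> fg; apply: ler_sum => a _; rewrite ler_pM2l//; apply: ler_Ex => //.
exact: law_subst_iter.
Qed.

Lemma pf_mean_iterD m k f :
  pf_mean (m + k) f = pf_mean m (fun v => Ex (iterate k v) f).
Proof. by apply: eq_bigr => a _; rewrite Ex_subst_iterD. Qed.

(** Substituting once multiplies the mean letter counts by the matrix, of which
    [Rvec] is an eigenvector; so additive functionals grow exactly as powers of
    [lambda], without error term. *)
Lemma pf_mean_sum m (f : letter -> R) :
  pf_mean m (fun w => \sum_(b <- w) f b) = lambda ^+ m * \sum_a Rvec a 0 * f a.
Proof.
elim: m f => [|m IH] f.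
  by rewrite mul1r; apply: eq_bigr => a _; rewrite Ex_fret big_seq1.
rewrite -addn1 pf_mean_iterD.
transitivity (pf_mean m (fun w => \sum_(b <- w)
    Ex (iterate 1 [:: b]) (fun v => \sum_(c <- v) f c))).
  by apply: eq_bigr => a _; congr (_ * _); apply: eq_Ex => w; rewrite Ex_subst_iter_sum.
rewrite IH exprD expr1 -mulrA; congr (_ * _); rewrite mulr_sumr.
have letters w : \sum_(c <- w) f c = \sum_c f c * (occ [:: c] w)%:R :> R.
  rewrite (sum_fibers _ id) map_id.
  transitivity (\sum_(c <- undup w) f c * (occ [:: c] w)%:R).
    apply: eq_bigr => c _; rewrite occ_letter (eq_bigr (fun=> f c)) => [|b /eqP->//].
    by rewrite big_const_seq iter_addr_0 mulr_natr.
  rewrite [RHS](bigID (mem (undup w)))/= [X in _ + X]big1 ?addr0; last first.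
    move=> c; rewrite mem_undup => cw; rewrite occ_letter.
    by rewrite (count_memPn cw) mulr0.
  by rewrite -big_uniq ?undup_uniq.
have colM b : Ex (iterate 1 [:: b]) (fun v => \sum_(c <- v) f c) =
    \sum_c f c * subst_matrix theta c b.
  rewrite Ex_subst_iterS Ex_fret Ex_subst_word_cons.
  transitivity (Ex (subst_letter theta b) (fun w => \sum_c f c * (occ [:: c] w)%:R)).
    by apply: eq_Ex => w; rewrite Ex_fret cats0 letters.
  by rewrite Ex_sum; apply: eq_bigr => c _; rewrite ExZ mxE.
transitivity (\sum_c f c * (subst_matrix theta *m Rvec) c 0).
  under eq_bigr do rewrite colM mulr_sumr.
  rewrite exchange_big; apply: eq_bigr => c _; rewrite mxE mulr_sumr.
  by apply: eq_bigr => b _; ring.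
by rewrite eigenR; apply: eq_bigr => c _; rewrite mxE; ring.
Qed.

Lemma pf_mean_size m : pf_mean m (fun w => (size w)%:R) = lambda ^+ m.
Proof.
transitivity (pf_mean m (fun w => \sum_(b <- w) 1)).
  by apply: eq_bigr => a _; congr (_ * _); apply: eq_Ex => w;
     rewrite big_const_seq count_predT iter_addr_0.
by rewrite pf_mean_sum; under eq_bigr do rewrite mulr1; rewrite Rvec_sum mulr1.
Qed.

(** Subadditivity: the mean of a sum over letters is computed by [pf_mean_sum]. *)
Lemma pf_entropyD_le m k :
  pf_entropy (m + k) <= pf_entropy m + lambda ^+ m * pf_entropy k.
Proof.
rewrite /pf_entropy -pf_mean_sum -big_split/=; apply: ler_sum => a _.
rewrite -mulrDr ler_pM2l//; apply: le_trans (shannon_subst_iterD _ _ _ _) _.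
rewrite lerD2l; apply: ler_Ex => [|w _]; first exact: law_subst_iter.
exact: shannon_subst_iter_le.
Qed.

(** For each starting letter [a] and each word [v] at time [m], the cut point
    estimate is applied with [D] the law of the word at time [m + k]. *)
Lemma pf_entropyD_ge m k (q : R) : 0 < q < 1 ->
  lambda ^+ m * pf_entropy k <= pf_entropy (m + k)
    - lambda ^+ m * ln q - (lambda ^+ (m + k) - lambda ^+ m) * ln (1 - q).
Proof.
move=> q01; rewrite -[lambda ^+ (m + k)]pf_mean_size -[lambda ^+ m in X in _ <= X]pf_mean_size.
rewrite -pf_mean_sum; pose len l a := Ex (iterate l [:: a]) (fun w : word => (size w)%:R : R).
have -> : pf_entropy (m + k) - pf_mean m (fun w => (size w)%:R) * ln q
    - (pf_mean (m + k) (fun w => (size w)%:R) - pf_mean m (fun w => (size w)%:R)) * ln (1 - q)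
  = \sum_a Rvec a 0 * (shannon (iterate (m + k) [:: a]) - len m a * ln q
      - (len (m + k)%N a - len m a) * ln (1 - q)).
  rewrite /pf_entropy /pf_mean -sumrB !mulr_suml -!sumrB; apply: eq_bigr => a _.
  by rewrite /len; ring.
apply: ler_sum => a _; rewrite ler_pM2l//.
have lmk := law_subst_iter theta (m + k) [:: a].
rewrite shannonE// /len !Ex_subst_iterD -!(ExM, ExB).
apply: ler_Ex => [|v va]; first exact: law_subst_iter.
have vD : {subset outcomes (iterate k v) <= outcomes (iterate (m + k) [:: a])}.
  by move=> w; exact: outcomes_subst_iterD.
apply: le_trans (shannon_cut_points lmk vD q01) _.
have lkv := law_subst_iter theta k v.
by rewrite !(ExM, ExB) !Ex_cst.
Qed.

End PFAverages.

(** * Counting windows *)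

Section ListSums.
Context (R : numDomainType).
Implicit Types s : seq R.

Lemma sum_take s n : \sum_(y <- take n s) y = \sum_(i < n) s`_i.
Proof.
elim: s n => [|x s IH] [|n]; rewrite ?big_nil ?big_ord0//=.
  by rewrite big1// => i _; rewrite nth_nil.
by rewrite big_cons big_ord_recl IH.
Qed.

Lemma sum_drop_le s n : {in s, forall y, 0 <= y} ->
  \sum_(y <- drop n s) y <= \sum_(y <- s) y.
Proof.
move=> s0; rewrite -{2}(cat_take_drop n s) big_cat/= lerDr big_seq.
by apply: sumr_ge0 => y /mem_take; exact: s0.
Qed.

(** Every entry lies in at most [n] windows of length [n]. *)
Lemma sum_windows_le s n : {in s, forall y, 0 <= y} ->
  \sum_(j < size s) \sum_(y <- take n (drop j s)) y <= n%:R * \sum_(y <- s) y.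
Proof.
move=> s0; under eq_bigr do rewrite sum_take.
rewrite exchange_big /= mulr_natl -[n in _ *+ n]card_ord -sumr_const.
apply: ler_sum => i _; apply: le_trans (sum_drop_le i s0).
have <- : take (size s) (drop i s) = drop i s.
  by rewrite take_oversize// size_drop leq_subr.
by rewrite sum_take; apply: ler_sum => j _; rewrite !nth_drop addnC.
Qed.

End ListSums.

Lemma word_sum_occ (R : realType) (d n : nat) (w : seq 'I_d.+1)
    (f : seq 'I_d.+1 -> R) :
  word_sum n (fun v => (occ v w)%:R * f v) =
  \sum_(j < size w) if (n <= size w - j)%N then f (take n (drop j w)) else 0.
Proof.
elim: w => [|a w IH].
  rewrite big_ord0 -[RHS](mulr0 (d.+1%:R ^+ n)) -word_sum_cst.
  by apply: eq_word_sum => v _; rewrite mul0r.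
by rewrite word_sum_occ_cons IH [size (a :: w)]/= big_ord_recl subn0 drop0.
Qed.

Section Windows.
Context (R : realType) (d : nat).
Local Notation word := (seq 'I_d.+1).
Variables (c cost : word -> R) (K : R) (len : nat).
Hypothesis K0 : 0 <= K.
Hypothesis c_nil : c [::] <= 0.
Hypothesis c_cons : forall a w, c (a :: w) <= K + c w.

Definition admissible_block (x : word) : Prop :=
  [/\ x != [::], (size x <= len)%N, 0 <= cost x
    & forall w, c (x ++ w) <= cost x + c w].

(** Charging the cost of a block to its last position makes a window pay for
    every block that ends in it, in particular for all complete ones. *)
Definition block_charge (x : word) : seq R := rcons (nseq (size x).-1 0) (cost x).

Definition charge (xs : seq word) : seq R := flatten [seq block_charge x | x <- xs].

Lemma charge_cons x xs : charge (x :: xs) = block_charge x ++ charge xs.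
Proof. by []. Qed.

Local Arguments charge : simpl never.

Lemma size_block_charge x : admissible_block x -> size (block_charge x) = size x.
Proof.
by case=> x0 _ _ _; rewrite size_rcons size_nseq prednK// lt0n size_eq0.
Qed.

Lemma sum_block_charge x : \sum_(y <- block_charge x) y = cost x.
Proof.
rewrite /block_charge -cats1 big_cat big_seq1 big_nseq iter_addr_0 mul0rn /=.
exact: add0r.
Qed.

Section Blocks.
Implicit Types xs : seq word.

Lemma size_charge xs : {in xs, forall x, admissible_block x} ->
  size (charge xs) = size (flatten xs).
Proof.
elim: xs => [|x xs IH] xsP //; rewrite charge_cons !size_cat.
rewrite size_block_charge; last exact/xsP/mem_head.
congr (_ + _)%N; apply: IH => y yxs.
by apply: xsP; rewrite inE yxs orbT.
Qed.

Lemma sum_charge xs : \sum_(y <- charge xs) y = \sum_(x <- xs) cost x.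
Proof.
by rewrite big_flatten big_map; apply: eq_bigr => x _; rewrite sum_block_charge.
Qed.

Lemma charge_ge0 xs : {in xs, forall x, admissible_block x} ->
  {in charge xs, forall y, 0 <= y}.
Proof.
move=> xsP y /flattenP[_ /mapP[x /xsP[_ _ cx _] ->]].
by rewrite mem_rcons inE => /predU1P[->//|/nseqP[->]].
Qed.

Lemma c_cat_le x w : c (x ++ w) <= K * (size x)%:R + c w.
Proof.
elim: x => [|a x IH] /=; first by rewrite mulr0 add0r.
by apply: le_trans (c_cons _ _) _; rewrite -natr1; lra.
Qed.

Lemma c_size_le w : c w <= K * (size w)%:R.
Proof. by move: c_nil (c_cat_le w [::]); rewrite cats0; lra. Qed.

Lemma c_short_le w : (size w <= len)%N -> c w <= K * len%:R.
Proof.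
by move=> wl; apply: le_trans (c_size_le w) _; rewrite ler_wpM2l// ler_nat.
Qed.

Lemma sum_take_ge0 (s : seq R) n : {in s, forall y, 0 <= y} ->
  0 <= \sum_(y <- take n s) y.
Proof. by move=> s0; rewrite big_seq sumr_ge0// => y /mem_take/s0. Qed.

Lemma c_prefix_le n xs : {in xs, forall x, admissible_block x} ->
  c (take n (flatten xs)) <= \sum_(y <- take n (charge xs)) y + K * len%:R.
Proof.
elim: xs n => [|x xs IH] n xsP.
  by rewrite /= big_nil add0r (le_trans c_nil)// mulr_ge0.
have xP : admissible_block x by exact/xsP/mem_head.
have xsP' : {in xs, forall x, admissible_block x}.
  by move=> y yxs; apply: xsP; rewrite inE yxs orbT.
have [_ xl _ cx] := xP.
have c0 := charge_ge0 xsP.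
case: (ltnP n (size x)) => nx.
  rewrite -[leLHS]add0r lerD ?sum_take_ge0//= take_cat nx c_short_le//.
  by rewrite size_take_min (leq_trans (geq_minr _ _)).
rewrite charge_cons /= !take_cat size_block_charge// ltnNge nx/= big_cat sum_block_charge/=.
by apply: le_trans (cx _) _; rewrite -addrA lerD2l IH.
Qed.

(** A window splits into the end of a block, complete blocks, and the beginning
    of a block; the two incomplete pieces are paid for letter by letter. *)
Lemma c_window_le n j xs : {in xs, forall x, admissible_block x} ->
  c (take n (drop j (flatten xs))) <=
  \sum_(y <- take n (drop j (charge xs))) y + K * len%:R *+ 2.
Proof.
elim: xs j => [|x xs IH] j xsP.
  by rewrite /= big_nil add0r (le_trans c_nil)// mulrn_wge0 ?mulr_ge0.
have xP : admissible_block x by exact/xsP/mem_head.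
have xsP' : {in xs, forall x, admissible_block x}.
  by move=> y yxs; apply: xsP; rewrite inE yxs orbT.
have [_ xl _ cx] := xP.
have c0 := charge_ge0 xsP.
have sx := size_block_charge xP.
case: (ltnP j (size x)) => jx; last first.
  by rewrite charge_cons /= !drop_cat sx ltnNge jx/= IH.
have dl : (size (drop j x) <= len)%N by rewrite size_drop (leq_trans (leq_subr _ _)).
have Kl : 0 <= K * len%:R by rewrite mulr_ge0.
have b0 : 0 <= \sum_(y <- drop j (block_charge x)) y.
  rewrite big_seq sumr_ge0// => y /mem_drop yx; apply: c0.
  by rewrite charge_cons mem_cat yx.
case: (ltnP n (size (drop j x))) => nx.
  rewrite /= drop_cat jx take_cat nx -[leLHS]add0r lerD//.
    by apply: sum_take_ge0 => y /mem_drop/c0.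
  rewrite mulr2n (le_trans (c_short_le _)) ?lerDl//.
  by rewrite size_take_min (leq_trans (geq_minr _ _)).
rewrite charge_cons /= !drop_cat sx jx !take_cat !size_drop sx -size_drop.
rewrite ltnNge nx/= big_cat/=.
apply: le_trans (c_cat_le _ _) _.
rewrite size_drop.
have := c_prefix_le (n - (size x - j)) xsP'.
have : K * (size x - j)%:R <= K * len%:R by rewrite -size_drop ler_wpM2l// ler_nat.
rewrite mulr2n; lra.
Qed.

(** By [sum_windows_le] applied to the charges, a block is paid for by at most
    [n] windows; besides, each window pays for at most [len] letters of a block
    cut at either of its ends. *)
Lemma sum_windows_cost_le n xs : {in xs, forall x, admissible_block x} ->
  word_sum n (fun v => (occ v (flatten xs))%:R * c v) <=
  n%:R * \sum_(x <- xs) cost x + K * len%:R *+ 2 * (size (flatten xs))%:R.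
Proof.
move=> xsP; have c0 := charge_ge0 xsP.
rewrite word_sum_occ -sum_charge.
apply: (@le_trans _ _ (\sum_(j < size (flatten xs))
  (\sum_(y <- take n (drop j (charge xs))) y + K * len%:R *+ 2))).
  apply: ler_sum => j _; case: ifP => _; first exact: c_window_le.
  rewrite addr_ge0 ?mulrn_wge0 ?mulr_ge0//.
  by apply: sum_take_ge0 => y /mem_drop/c0.
rewrite big_split/= sumr_const card_ord -size_charge// -[X in _ + X]mulr_natr lerD2r.
exact: sum_windows_le.
Qed.

End Blocks.
End Windows.

(** * Coding by substituted letters *)

Section BlockCode.
Context (R : realType) (d : nat) (theta : random_substitution R d) (m : nat).
Local Notation word := (seq 'I_d.+1).
Local Notation iterate k u := (subst_iter theta k u).

(** A block is, with probability one half each, a single uniform letter or the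
    [m]-th iterate of a uniform letter. The former keeps every word codable,
    including the pieces of blocks at the ends of a window. *)
Definition block_weight (x : word) : R :=
  (2 * d.+1%:R)^-1 * ((size x == 1%N)%:R + \sum_b Pr (iterate m [:: b]) x).

Definition letter_cost : R := ln (2 * d.+1%:R).

Definition block_cost (x : word) : R := - ln (block_weight x).

Definition word_cost (w : word) : R := - ln (parse_sum block_weight w).

Let A0 : 0 < 2 * d.+1%:R :> R. Proof. by rewrite mulr_gt0// ltr0n. Qed.

Let law_m b : is_law (iterate m [:: b]). Proof. exact: law_subst_iter. Qed.

Lemma letter_cost_ge0 : 0 <= letter_cost.
Proof. by rewrite ln_ge0// -natrM ler1n muln_gt0. Qed.

Lemma block_weight_ge0 x : 0 <= block_weight x.
Proof.
apply: mulr_ge0; first by rewrite invr_ge0 ltW.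
by apply: addr_ge0 => //; apply: sumr_ge0 => b _; exact: Pr_ge0.
Qed.

Lemma sum_block_weight_le1 n : \sum_(1 <= i < n.+1) word_sum i block_weight <= 1.
Proof.
have -> : \sum_(1 <= i < n.+1) word_sum i block_weight = (2 * d.+1%:R)^-1 *
    (\sum_(1 <= i < n.+1) word_sum i (fun x : word => (size x == 1%N)%:R)
      + \sum_b \sum_(1 <= i < n.+1) word_sum i (Pr (iterate m [:: b]))).
  rewrite exchange_big -big_split mulr_sumr; apply: eq_bigr => i _.
  by rewrite /= -word_sum_big -word_sumD -word_sumZ.
rewrite ler_pdivrMl// mulr1 mulr_natl mulr2n; apply: lerD.
  have one i : word_sum i (fun x : word => (size x == 1%N)%:R) =
      (i == 1%N)%:R * d.+1%:R ^+ i :> R.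
    rewrite mulrC -word_sum_cst; apply: eq_word_sum => x xi.
    by rewrite xi.
  under eq_bigr do rewrite one.
  case: n => [|n]; first by rewrite big_geq.
  rewrite big_ltn// mul1r expr1 big_nat big1 ?addr0// => i /andP[i2 _].
  by rewrite gtn_eqF ?mul0r.
rewrite -[leRHS]mul1r mulr_natr -[in leRHS](card_ord d.+1) -sumr_const.
apply: ler_sum => b _; under eq_bigr do rewrite word_sum_Pr.
rewrite -Ex_sum -[leRHS](Ex_cst 1 (law_m b)); apply: ler_Ex => // x _.
have [x0|x0] := boolP (size x \in index_iota 1 n.+1).
  rewrite (bigD1_seq (size x)) ?iota_uniq//= eqxx big1 ?addr0// => i.
  by rewrite eq_sym; case: eqP.
rewrite big_seq big1 ?ler01// => i xi; case: eqP => // ix.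
by rewrite ix xi in x0.
Qed.

Lemma block_weight_letter a : 0 < block_weight [:: a].
Proof.
apply: mulr_gt0; first by rewrite invr_gt0.
by apply: ltr_pwDl => //; apply: sumr_ge0 => b _; exact: Pr_ge0.
Qed.

Lemma block_weight_le1 x : x != [::] -> block_weight x <= 1.
Proof.
move=> x0; apply: le_trans (ler_term_word_sum x block_weight_ge0) _.
apply: le_trans (sum_block_weight_le1 (size x)).
rewrite big_nat_recr/= ?lt0n ?size_eq0// lerDr; apply: sumr_ge0 => i _.
exact/word_sum_ge0/block_weight_ge0.
Qed.

Lemma parse_sum_gt0 w : 0 < parse_sum block_weight w.
Proof.
elim: w => [|a w IH]; first by rewrite parse_sum_nil.
apply: lt_le_trans (parse_sum_cat block_weight_ge0 w (isT : [:: a] != [::])).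
by rewrite mulr_gt0// block_weight_letter.
Qed.

Lemma word_cost_nil : word_cost [::] <= 0.
Proof. by rewrite /word_cost parse_sum_nil ln1 oppr0. Qed.

Lemma word_cost_cat x w : x != [::] -> 0 < block_weight x ->
  word_cost (x ++ w) <= block_cost x + word_cost w.
Proof.
move=> x0 gx; rewrite -opprD -lnM ?posrE ?parse_sum_gt0// lerN2.
have gQ := mulr_gt0 gx (parse_sum_gt0 w).
rewrite ler_ln ?posrE ?parse_sum_gt0//.
exact: (parse_sum_cat block_weight_ge0).
Qed.

Lemma word_cost_cons a w : word_cost (a :: w) <= letter_cost + word_cost w.
Proof.
apply: le_trans (word_cost_cat w (isT : [:: a] != [::]) (block_weight_letter a)) _.
rewrite lerD2r -[letter_cost]opprK lerN2 -lnV ?posrE//.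
rewrite ler_ln ?posrE ?invr_gt0 ?block_weight_letter// ler_pMr ?invr_gt0//.
by rewrite lerDl; apply: sumr_ge0 => b _; exact: Pr_ge0.
Qed.

Section Image.
Variables (b : 'I_d.+1) (x : word).
Hypothesis xb : x \in outcomes (iterate m [:: b]).

Let Px0 : 0 < Pr (iterate m [:: b]) x. Proof. by rewrite Pr_gt0. Qed.

Let le_block_weight : (2 * d.+1%:R)^-1 * Pr (iterate m [:: b]) x <= block_weight x.
Proof.
rewrite ler_pM2l ?invr_gt0// (bigD1 b)//= addrCA lerDl.
by apply: addr_ge0 => //; apply: sumr_ge0 => c _; exact: Pr_ge0.
Qed.

Lemma block_weight_gt0 : 0 < block_weight x.
Proof. by apply: lt_le_trans le_block_weight; rewrite mulr_gt0 ?invr_gt0. Qed.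

Lemma block_cost_le : block_cost x <= letter_cost - ln (Pr (iterate m [:: b]) x).
Proof.
have Ai : 0 < (2 * d.+1%:R)^-1 :> R by rewrite invr_gt0.
rewrite -[letter_cost]opprK -opprD lerN2 -lnV ?posrE// -lnM ?posrE//.
by rewrite ler_ln ?posrE ?block_weight_gt0// mulr_gt0.
Qed.

End Image.

Lemma Ex_block_cost_le b : Ex (iterate m [:: b]) block_cost <=
  letter_cost + shannon (iterate m [:: b]).
Proof.
rewrite shannonE// -[X in X + _](Ex_cst _ (law_m b)) -ExD.
by apply: ler_Ex => // x; exact: block_cost_le.
Qed.

Definition max_image_size : nat :=
  \max_(b : 'I_d.+1) \max_(x <- outcomes (iterate m [:: b])) size x.

Lemma image_admissible b x : x \in outcomes (iterate m [:: b]) ->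
  admissible_block word_cost block_cost max_image_size x.
Proof.
move=> xb; have x0 : x != [::].
  by have := size_subst_iter xb; rewrite -size_eq0 -lt0n.
split=> //; last by move=> w; rewrite word_cost_cat// (block_weight_gt0 xb).
  apply: leq_trans (leq_bigmax b).
  exact: (leq_bigmax_seq (F := fun x : word => size x) x xb).
by rewrite oppr_ge0 ln_le0// block_weight_le1.
Qed.

(** The windows of the image of [u] are parsed along the images of its letters. *)
Lemma Ex_windows_cost_le n u :
  Ex (iterate m u) (fun w => word_sum n (fun v => (occ v w)%:R * word_cost v)) <=
  n%:R * \sum_(b <- u) (letter_cost + shannon (iterate m [:: b]))
    + letter_cost * max_image_size%:R *+ 2 * Ex (iterate m u) (fun w => (size w)%:R).
Proof.
apply: (@le_trans _ _ (n%:R * \sum_(b <- u) Ex (iterate m [:: b]) block_cost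
    + letter_cost * max_image_size%:R *+ 2 * Ex (iterate m u) (fun w => (size w)%:R))).
  rewrite -Ex_blocks_sum !Ex_blocks_flatten -!ExZ -ExD.
  apply: ler_Ex => [|xs xsu]; first exact: law_blocks.
  apply: sum_windows_cost_le.
  - exact: letter_cost_ge0.
  - exact: word_cost_nil.
  - exact: word_cost_cons.
  by move=> x /(mem_blocks xsu)[b _]; exact: image_admissible.
by rewrite lerD2r ler_wpM2l// ler_sum// => b _; exact: Ex_block_cost_le.
Qed.

Lemma word_sum_word_cost_kraft n : word_sum n (fun w => expR (- word_cost w)) <= 1.
Proof.
apply: le_trans (word_sum_parse_sum block_weight_ge0 sum_block_weight_le1 n).
by apply: ler_word_sum => w _; rewrite opprK lnK ?posrE ?parse_sum_gt0.
Qed.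

End BlockCode.

(** * Markov codes *)

Section MarkovCode.
Context (R : realType) (d n : nat).
Local Notation word := (seq 'I_d.+1).
Variable q : word -> R.
Hypothesis q_gt0 : forall w, 0 < q w.
Hypothesis q_sum : forall v, size v = n -> \sum_a q (a :: v) = 1.

(** The probability of a word when letters are drawn from right to left, each
    given the [n] letters that follow it; [q (a :: v)] is the probability of
    [a] given [v]. The last [n] letters are uniform. *)
Fixpoint markov_code w : R :=
  if w is a :: w' then
    (if (n <= size w')%N then q (take n.+1 w) else d.+1%:R^-1) * markov_code w'
  else 1.

Lemma markov_code_gt0 w : 0 < markov_code w.
Proof. by elim: w => //= a w IH; rewrite mulr_gt0//; case: ifP. Qed.

Lemma word_sum_markov_code l : word_sum l markov_code = 1.
Proof.
elim: l => [|l IH] //=; rewrite -word_sum_big -[RHS]IH; apply: eq_word_sum => w wl.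
rewrite -mulr_suml; case: (boolP (n <= size w)%N) => nw; last first.
  by rewrite sumr_const card_ord -(mulr_natr d.+1%:R^-1 d.+1) mulVf ?mul1r// pnatr_eq0.
by rewrite q_sum ?mul1r// size_takel.
Qed.

Lemma ln_markov_code w : - ln (markov_code w) <= n%:R * ln d.+1%:R
  + word_sum n.+1 (fun z => (occ z w)%:R * - ln (q z)).
Proof.
have lnA : 0 <= ln d.+1%:R :> R by rewrite ln_ge0// ler1n.
suff -> : - ln (markov_code w) = (minn (size w) n)%:R * ln d.+1%:R
    + word_sum n.+1 (fun z => (occ z w)%:R * - ln (q z)).
  by rewrite lerD2r ler_wpM2r// ler_nat geq_minr.
elim: w => [|a w IH].
  rewrite [markov_code _]/= ln1 min0n mul0r oppr0 add0r.
  rewrite -[LHS](mulr0 (d.+1%:R ^+ n.+1)) -word_sum_cst.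
  by apply: eq_word_sum => z _; rewrite mul0r.
rewrite word_sum_occ_cons ltnS [markov_code _]/= [size (a :: w)]/=.
rewrite lnM ?posrE ?markov_code_gt0//; last by case: ifP.
rewrite opprD IH; case: leqP => nw.
  by rewrite (minn_idPr (leqW nw)); ring.
by rewrite lnV ?posrE// opprK (minn_idPl nw) -natr1; ring.
Qed.

(** The length of the word is described by a geometric law of ratio [r]. *)
Lemma shannon_markov_le (D : fdist R word) (r : R) : is_law D -> 0 < r < 1 ->
  shannon D <= - ln (1 - r) + n%:R * ln d.+1%:R - Ex D (fun w => (size w)%:R) * ln r
    + word_sum n.+1 (fun z => Ex D (fun w => (occ z w)%:R) * - ln (q z)).
Proof.
move=> lD /andP[r0 r1]; have r1' : 0 < 1 - r by rewrite subr_gt0.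
pose code (w : word) := (1 - r) * r ^+ size w * markov_code w.
have lr0 w : 0 < (1 - r) * r ^+ size (w : word) by rewrite mulr_gt0 ?exprn_gt0.
have code0 w : 0 < code w by rewrite mulr_gt0 ?markov_code_gt0.
apply: le_trans (gibbs (q := code) lD (fun x _ => code0 x) _) _.
  (* Kraft sum: length by length, the Markov code sums to 1, leaving the
     geometric weights of the lengths. *)
  pose N := (\max_(w <- undup (outcomes D)) size w).+1.
  apply: (le_trans (sum_words_le (N := N) (undup_uniq _) (fun w => ltW (code0 w)) _)).
    by move=> w wD; rewrite ltnS; exact: (leq_bigmax_seq (F := fun w : word => size w) w wD).
  apply: le_trans (sum_geometric_le1 N (ltW r0)); apply: ler_sum => i _.
  rewrite -[leRHS]mulr1 -[X in _ * X](word_sum_markov_code i) -word_sumZ.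
  by apply: ler_word_sum => w wi; rewrite /code wi.
have -> : word_sum n.+1 (fun z => Ex D (fun w => (occ z w)%:R) * - ln (q z))
    = Ex D (fun w => word_sum n.+1 (fun z => (occ z w)%:R * - ln (q z))).
  by rewrite -word_sum_Ex; apply: eq_word_sum => z _; rewrite ExM.
rewrite -ExM -[X in X - _ + _](Ex_cst _ lD) -ExB -ExD; apply: ler_Ex => // w _.
rewrite /code lnM ?posrE ?markov_code_gt0// lnM ?posrE ?exprn_gt0// lnXn// -mulr_natl.
have := ln_markov_code w; lra.
Qed.

End MarkovCode.

(** * Word frequencies *)

Section Frequencies.
Context (R : realType) (d : nat) (theta : random_substitution R d).
Context (lambda : R) (Rvec : 'cV[R]_d.+1).
Local Notation letter := 'I_d.+1.
Local Notation word := (seq letter).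
Local Notation iterate k u := (subst_iter theta k u).
Local Notation pf_mean := (pf_mean theta Rvec).
Local Notation pf_entropy := (pf_entropy theta Rvec).

Hypothesis eigenR : subst_matrix theta *m Rvec = lambda *: Rvec.
Hypothesis Rvec_gt0 : forall a, 0 < Rvec a 0.
Hypothesis Rvec_sum : \sum_a Rvec a 0 = 1.
Hypothesis lambda_gt1 : 1 < lambda.

Definition frequency m (v : word) : R :=
  lambda ^- m * pf_mean m (fun w => (occ v w)%:R).

Variable p : word -> R.
Hypothesis frequency_cvg : forall v, frequency^~ v @ \oo --> p v.

Definition word_entropy n : R := word_sum n (fun v => - (p v * ln (p v))).

Definition normalized_entropy m : R := lambda ^- m * pf_entropy m.

Let lambda_gt0 : 0 < lambda. Proof. exact: lt_trans lambda_gt1. Qed.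

Let lambdaX_gt0 m : 0 < lambda ^- m. Proof. by rewrite invr_gt0 exprn_gt0. Qed.

Lemma cvg_expVn : (fun m => lambda ^- m) @ \oo --> 0.
Proof.
under eq_fun do rewrite -exprVn; apply: cvg_expr.
by rewrite gtr0_norm ?invr_gt0// invf_lt1.
Qed.

Lemma cvg_sum_seq (I : Type) (r : seq I) (F : nat -> I -> R) (f : I -> R) :
  (forall i, F^~ i @ \oo --> f i) ->
  (fun m => \sum_(i <- r) F m i) @ \oo --> \sum_(i <- r) f i.
Proof.
by move=> Ff; apply: (cvg_big (op := +%R)) => //; exact: add_continuous.
Qed.

Lemma cvg_word_sum n (F : nat -> word -> R) (f : word -> R) :
  (forall v, F^~ v @ \oo --> f v) ->
  (fun m => word_sum n (F m)) @ \oo --> word_sum n f.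
Proof.
elim: n F f => [|n IH] F f Ff /=; first exact: Ff.
apply: cvg_sum_seq => a; apply: (IH (fun m w => F m (a :: w))) => v; exact: Ff.
Qed.

Lemma frequency_limit_ge0 v : 0 <= p v.
Proof.
apply: (cvgr_to_ge (frequency_cvg (v := v))); apply: nearW => m.
apply: mulr_ge0; first exact: ltW.
rewrite -(pf_mean_cst theta Rvec_sum m 0).
by apply: ler_pf_mean => // a w _; rewrite ler0n.
Qed.

Lemma frequency_limit_nil : p [::] = 1.
Proof.
apply: (cvg_unique (@norm_hausdorff _ R) (frequency_cvg (v := [::]))).
have -> : frequency^~ [::] = fun=> 1; last exact: cvg_cst.
apply/funext => m; rewrite /frequency.
have -> : pf_mean m (fun w => (occ [::] w)%:R) = pf_mean m (fun w => (size w)%:R).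
  by apply: eq_bigr => a _; congr (_ * _); apply: eq_Ex => w; rewrite occ_nil.
by rewrite (pf_mean_size eigenR)// mulVf// gt_eqF// exprn_gt0.
Qed.

Lemma frequency_limit_cons v : \sum_a p (a :: v) = p v.
Proof.
pose e m := frequency m v - \sum_a frequency m (a :: v).
have ecvg : e @ \oo --> p v - \sum_a p (a :: v).
  by apply: cvgB => //; apply: cvg_sum_seq.
have eabs m : `|e m| <= lambda ^- m.
  have -> : e m = lambda ^- m * pf_mean m (fun w => (prefix v w)%:R - (v == [::])%:R).
    rewrite /e /frequency -mulr_sumr -mulrBr; congr (_ * _).
    rewrite /pf_mean exchange_big -sumrB; apply: eq_bigr => a _.
    rewrite -mulr_sumr -mulrBr; congr (_ * _); rewrite -Ex_sum -ExB.
    apply: eq_Ex => w; have := sum_occ_cons v w => /(congr1 (fun i => i%:R : R)).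
    by rewrite !natrD natr_sum; lra.
  rewrite normrM gtr0_norm//; apply: ler_piMr; first exact: ltW.
  rewrite ler_norml -{1}(pf_mean_cst theta Rvec_sum m (-1)).
  rewrite -[X in _ && (_ <= X)](pf_mean_cst theta Rvec_sum m 1).
  by apply/andP; split; apply: ler_pf_mean => // a w _;
     case: (prefix _ _); case: (_ == _); rewrite /=; lra.
have e0 : e @ \oo --> (0 : R).
  apply: norm_cvg0; apply: (squeeze_cvgr _ (cvg_cst 0) cvg_expVn).
  by apply: nearW => m; rewrite normr_ge0 eabs.
have /eqP : p v - \sum_a p (a :: v) = 0.
  exact: (cvg_unique (@norm_hausdorff _ R) ecvg e0).
by rewrite subr_eq0 => /eqP ->.
Qed.

Lemma word_sum_frequency_limit n : word_sum n p = 1.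
Proof.
elim: n => [|n IH]; first exact: frequency_limit_nil.
rewrite /= -word_sum_big -IH; apply: eq_word_sum => v _.
exact: frequency_limit_cons.
Qed.



(** The transition probabilities given by [p], mixed with a little uniform noise
    so that every transition is possible. *)
Definition smoothed_transition (del : R) (z : word) : R :=
  (p z + del) / (p (behead z) + del * d.+1%:R).

Lemma smoothed_transition_gt0 del z : 0 < del -> 0 < smoothed_transition del z.
Proof.
by move=> del0; rewrite divr_gt0// ltr_wpDl ?frequency_limit_ge0// mulr_gt0//.
Qed.

Lemma smoothed_transition_sum del v : 0 < del ->
  \sum_a smoothed_transition del (a :: v) = 1.
Proof.
move=> del0; rewrite /smoothed_transition /= -mulr_suml big_split/=.
rewrite frequency_limit_cons sumr_const card_ord mulr_natr divff//.
by rewrite gt_eqF// ltr_wpDl ?frequency_limit_ge0// -mulr_natr mulr_gt0.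
Qed.

(** In [ln (p v + del A) - ln (p (a v) + del)], with [A] letters, the noise in
    the second term only helps, and in the first term it costs at most
    [del A / p v] by [ln (1 + x) <= x]; summed against [p] this is [del A] for
    each word [v]. *)
Lemma smoothed_transition_entropy_le n del : 0 < del ->
  word_sum n.+1 (fun z => p z * - ln (smoothed_transition del z)) <=
  word_entropy n.+1 - word_entropy n + del * d.+1%:R ^+ n.+1.
Proof.
move=> del0; have A0 : 0 < d.+1%:R :> R by rewrite ltr0n.
have den0 v : 0 < p v + del * d.+1%:R.
  by rewrite ltr_wpDl ?frequency_limit_ge0// mulr_gt0.
have num0 v : 0 < p v + del by rewrite ltr_wpDl ?frequency_limit_ge0.
apply: (@le_trans _ _ (word_sum n.+1 (fun z =>
    p z * ln (p (behead z) + del * d.+1%:R) + - (p z * ln (p z))))).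
  apply: ler_word_sum => z _; rewrite ln_div ?posrE// opprB mulrBr lerD2l lerN2.
  have := frequency_limit_ge0 z; rewrite le_eqVlt => /predU1P[<-|pz0].
    by rewrite !mul0r.
  by rewrite ler_pM2l// ler_ln ?posrE// lerDl ltW.
rewrite word_sumD addrC -addrA lerD2l.
have -> : word_sum n.+1 (fun z => p z * ln (p (behead z) + del * d.+1%:R)) =
    word_sum n (fun v => p v * ln (p v + del * d.+1%:R)).
  rewrite /= -word_sum_big; apply: eq_word_sum => v _.
  by rewrite -mulr_suml frequency_limit_cons.
rewrite /word_entropy -word_sumN exprSr mulrCA -word_sum_cst -word_sumD.
apply: ler_word_sum => v _; rewrite opprK.
have := frequency_limit_ge0 v; rewrite le_eqVlt => /predU1P[<-|pv0].
  by rewrite !mul0r add0r mulr_ge0 ?ltW.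
have -> : p v + del * d.+1%:R = p v * (1 + del * d.+1%:R / p v).
  by rewrite mulrDr mulr1 mulrCA divff ?mulr1// gt_eqF.
have x0 : 0 < del * d.+1%:R / p v by rewrite divr_gt0 ?mulr_gt0.
rewrite lnM ?posrE ?addr_gt0// mulrDr lerD2l.
have : p v * ln (1 + del * d.+1%:R / p v) <= p v * (del * d.+1%:R / p v).
  by rewrite ler_pM2l// le_ln1Dx// (lt_trans _ x0)// ltrN10.
by move=> /le_trans; apply; rewrite mulrCA divff ?mulr1// gt_eqF.
Qed.

(** The word at time [m] is coded by the Markov code of the smoothed transitions.
    Its cost is a linear function of the numbers of occurrences of words of
    length [n + 1], so it converges once divided by [lambda^m]; the constants in
    the cost disappear as [lambda > 1]. *)
Lemma entropy_le_increment n eps : 0 < eps -> \forall m \near \oo,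
  normalized_entropy m <= word_entropy n.+1 - word_entropy n + eps.
Proof.
move=> eps0; have A0 : 0 < d.+1%:R :> R by rewrite ltr0n.
(* One third for the code of the length, one third for the smoothing, and one
   third for the convergence of the cost. *)
pose e := eps / 3; have e0 : 0 < e by rewrite divr_gt0.
pose del := e / d.+1%:R ^+ n.+1; have del0 : 0 < del by rewrite divr_gt0 ?exprn_gt0.
pose r := expR (- e).
have r01 : 0 < r < 1 by rewrite expR_gt0/= expR_lt1 oppr_lt0.
pose q := smoothed_transition del.
pose G m := lambda ^- m * (- ln (1 - r) + n%:R * ln d.+1%:R) + e
  + word_sum n.+1 (fun z => frequency m z * - ln (q z)).
have q0 z : 0 < q z by exact: smoothed_transition_gt0.
have q1 v : size v = n -> \sum_a q (a :: v) = 1 by move=> _; exact: smoothed_transition_sum.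
have sG m : normalized_entropy m <= G m.
  have Gm : G m = lambda ^- m * ((- ln (1 - r) + n%:R * ln d.+1%:R)
      - pf_mean m (fun w => (size w)%:R) * ln r
      + word_sum n.+1 (fun z => pf_mean m (fun w => (occ z w)%:R) * - ln (q z))).
    have fr : word_sum n.+1 (fun z => frequency m z * - ln (q z)) = lambda ^- m *
        word_sum n.+1 (fun z => pf_mean m (fun w => (occ z w)%:R) * - ln (q z)).
      by rewrite -word_sumZ; apply: eq_word_sum => z _; rewrite mulrA.
    rewrite /G fr (pf_mean_size eigenR)// expRK; field.
    by rewrite expf_neq0// gt_eqF.
  rewrite Gm ler_pM2l// -[X in _ <= X - _ + _](pf_mean_cst theta Rvec_sum m).
  rewrite [X in _ <= _ + X](_ : _ = \sum_a Rvec a 0 * word_sum n.+1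
      (fun z => Ex (iterate m [:: a]) (fun w => (occ z w)%:R) * - ln (q z))); last first.
    under [RHS]eq_bigr do rewrite -word_sumZ.
    rewrite -word_sum_big; apply: eq_word_sum => z _.
    by rewrite mulr_suml; apply: eq_bigr => a _; rewrite mulrA.
  rewrite mulr_suml -sumrB -big_split/=; apply: ler_sum => a _.
  have la := law_subst_iter theta m [:: a].
  rewrite -mulrA -mulrBr -mulrDr ler_pM2l// Ex_cst//.
  exact: shannon_markov_le.
have Gcvg : G @ \oo --> 0 * (- ln (1 - r) + n%:R * ln d.+1%:R) + e
    + word_sum n.+1 (fun z => p z * - ln (q z)).
  apply: cvgD; first by apply: cvgD; [apply: cvgMl; exact: cvg_expVn|exact: cvg_cst].
  by apply: cvg_word_sum => z; apply: cvgMl; exact: frequency_cvg.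
have small : 0 * (- ln (1 - r) + n%:R * ln d.+1%:R) + e
    + word_sum n.+1 (fun z => p z * - ln (q z))
    < word_entropy n.+1 - word_entropy n + eps.
  have := smoothed_transition_entropy_le n del0; rewrite -/q.
  rewrite divfK ?gt_eqF ?exprn_gt0//.
  have : eps = e + e + e by rewrite /e; lra.
  rewrite mul0r; lra.
near=> m; apply: le_trans (sG m) _; apply: ltW; near: m.
exact: cvgr_lt Gcvg _ small.
Unshelve. all: by end_near. Qed.

(** As for finite laws; that [p] has total mass 1 on the words of each length
    follows from its consistency. *)
Lemma word_entropy_gibbs n (c : word -> R) :
  word_sum n (fun w => expR (- c w)) <= 1 ->
  word_entropy n <= word_sum n (fun v => p v * c v).
Proof.
move=> c1; apply: (@le_trans _ _ (word_sum n (fun v =>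
    p v * c v + (expR (- c v) - p v)))).
  apply: ler_word_sum => v _.
  have := entropy_term_le (frequency_limit_ge0 v) (expR_gt0 (- c v)).
  by rewrite expRK mulrN opprK.
rewrite word_sumD word_sumB word_sum_frequency_limit; lra.
Qed.

(** The words of length [n] are coded by the renewal code. Its mean length under
    [p] is the limit of its mean over the windows of the word at time [l + m],
    which is viewed as the image under [m] steps of the word at time [l]: each
    of the blocks, [lambda^l] in mean, is counted in at most [n] windows. *)
Lemma word_entropy_le m : exists C, forall n, word_entropy n <=
  n%:R * (normalized_entropy m + lambda ^- m * letter_cost R d) + C.
Proof.
exists (letter_cost R d * (max_image_size theta m)%:R *+ 2) => n.
apply: le_trans (word_entropy_gibbs (word_sum_word_cost_kraft theta m n)) _.
have Fcvg : (fun k => word_sum n (fun v => frequency k v * word_cost theta m v)) @ \oo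
    --> word_sum n (fun v => p v * word_cost theta m v).
  by apply: cvg_word_sum => v; apply: cvgMl; exact: frequency_cvg.
apply: (cvgr_to_le Fcvg); near=> k.
have -> : k = (k - m + m)%N by rewrite subnK//; near: k; exact: nbhs_infty_ge.
move: (k - m)%N => l.
have -> : word_sum n (fun v => frequency (l + m) v * word_cost theta m v) =
    lambda ^- (l + m) * pf_mean l (fun u => Ex (iterate m u) (fun w =>
      word_sum n (fun v => (occ v w)%:R * word_cost theta m v))).
  rewrite -pf_mean_iterD.
  transitivity (word_sum n (fun v => lambda ^- (l + m) *
     \sum_a Rvec a 0 * Ex (iterate (l + m) [:: a])
       (fun w => (occ v w)%:R * word_cost theta m v))).
    apply: eq_word_sum => v _; rewrite /frequency -mulrA; congr (_ * _).
    by rewrite mulr_suml; apply: eq_bigr => a _; rewrite ExM mulrA.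
  rewrite word_sumZ word_sum_big; congr (_ * _); apply: eq_bigr => a _.
  by rewrite word_sumZ word_sum_Ex.
set C := letter_cost R d * _ *+ 2.
have le1 : pf_mean l (fun u => Ex (iterate m u) (fun w =>
      word_sum n (fun v => (occ v w)%:R * word_cost theta m v))) <=
    n%:R * (lambda ^+ l * (letter_cost R d + pf_entropy m)) + C * lambda ^+ (l + m).
  rewrite -[lambda ^+ (l + m)](pf_mean_size eigenR Rvec_sum) pf_mean_iterD.
  have -> : letter_cost R d + pf_entropy m =
      \sum_a Rvec a 0 * (letter_cost R d + shannon (iterate m [:: a])).
    rewrite -{1}[letter_cost R d]mul1r -Rvec_sum mulr_suml -big_split.
    by apply: eq_bigr => a _; rewrite mulrDr.
  rewrite -(pf_mean_sum eigenR) -!pf_meanZ -pf_meanD.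
  by apply: ler_pf_mean => // a u _; exact: Ex_windows_cost_le.
apply: (@le_trans _ _ (lambda ^- (l + m) * (n%:R * (lambda ^+ l *
    (letter_cost R d + pf_entropy m)) + C * lambda ^+ (l + m)))).
  by rewrite ler_pM2l.
rewrite /normalized_entropy exprD le_eqVlt; apply/orP; left; apply/eqP; field.
by rewrite !expf_neq0// gt_eqF.
Unshelve. all: by end_near. Qed.

Lemma word_entropy_0 : word_entropy 0 = 0.
Proof. by rewrite /word_entropy /= frequency_limit_nil ln1 mulr0 oppr0. Qed.

Lemma word_entropy_ge0 n : 0 <= word_entropy n.
Proof.
rewrite -(mulr0 (d.+1%:R ^+ n)) -word_sum_cst; apply: ler_word_sum => v vn.
rewrite oppr_ge0 mulr_ge0_le0 ?frequency_limit_ge0// ln_le0//.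
rewrite -(word_sum_frequency_limit n) -vn; apply: ler_term_word_sum.
exact: frequency_limit_ge0.
Qed.

(** The increments of [word_entropy] bounding [normalized_entropy] telescope. *)
Lemma normalized_entropy_le_word n eps : 0 < eps -> \forall m \near \oo,
  n%:R * normalized_entropy m <= word_entropy n + n%:R * eps.
Proof.
move=> eps0; elim: n => [|n IH].
  by apply: nearW => m; rewrite !mul0r word_entropy_0 addr0.
near=> m; rewrite -natr1 !mulrDl !mul1r.
have : n%:R * normalized_entropy m <= word_entropy n + n%:R * eps by near: m.
have : normalized_entropy m <= word_entropy n.+1 - word_entropy n + eps.
  by near: m; exact: entropy_le_increment.
lra.
Unshelve. all: by end_near. Qed.

(** * The entropy rate *)

(** The infimum exists as entropies are nonnegative; the comparisons between [normalized_entropy] and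
    [word_entropy] in both directions make it the limit of either. *)
Definition entropy_rate : R :=
  inf (range (fun n => word_entropy n.+1 / n.+1%:R)).

Let rate_has_inf : has_inf (range (fun n => word_entropy n.+1 / n.+1%:R)).
Proof.
split; first by exists (word_entropy 1 / 1%:R), 0%N.
by exists 0 => _ [n _ <-]; rewrite divr_ge0// word_entropy_ge0.
Qed.

Let entropy_rate_le n : entropy_rate <= word_entropy n.+1 / n.+1%:R.
Proof. by apply: ge_inf; [exact: rate_has_inf.2|exists n]. Qed.

Lemma entropy_rate_le_normalized m :
  entropy_rate <= normalized_entropy m + lambda ^- m * letter_cost R d.
Proof.
have [C HC] := word_entropy_le m.
set s := _ + _ in HC *.
have lim : (fun n => s + C * n.+1%:R^-1) @ \oo --> s + C * 0.
  by apply: cvgD; [exact: cvg_cst|apply: cvgMr; exact: cvg_harmonic].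
rewrite -[s]addr0 -(mulr0 C); apply: (cvgr_to_ge lim); apply: nearW => n.
apply: le_trans (entropy_rate_le n) _.
by rewrite ler_pdivrMr ?ltr0n// mulrDl divfK ?pnatr_eq0// [s * _]mulrC.
Qed.

Lemma cvg_normalized_entropy : normalized_entropy @ \oo --> entropy_rate.
Proof.
apply/cvgrPdist_le => eps eps0.
have e2 : 0 < eps / 2 by rewrite divr_gt0.
have [_ [n _ <-] ne] := inf_adherent e2 rate_has_inf.
have Kcvg : (fun m => lambda ^- m * letter_cost R d) @ \oo --> 0 * letter_cost R d.
  by apply: cvgMl; exact: cvg_expVn.
have Kev : \forall m \near \oo, lambda ^- m * letter_cost R d < eps.
  have eps1 : 0 * letter_cost R d < eps by rewrite mul0r.
  exact: (cvgr_lt _ Kcvg _ eps1).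
near=> m; rewrite ler_norml; apply/andP; split; last first.
  have : lambda ^- m * letter_cost R d < eps by near: m.
  by have := entropy_rate_le_normalized m; lra.
have : n.+1%:R * normalized_entropy m <= word_entropy n.+1 + n.+1%:R * (eps / 2).
  by near: m; exact: normalized_entropy_le_word.
rewrite -ler_pdivlMl ?ltr0n// mulrDr mulKf ?pnatr_eq0// [n.+1%:R^-1 * _]mulrC.
have : word_entropy n.+1 / n.+1%:R < entropy_rate + eps / 2 := ne.
by move: (_ / n.+1%:R) => x; lra.
Unshelve. all: by end_near. Qed.

Lemma cvg_word_entropy_rate :
  (fun n => n%:R^-1 * word_entropy n) @ \oo --> entropy_rate.
Proof.
rewrite -(cvg_shiftS (fun n => n%:R^-1 * word_entropy n)) /=.
apply/cvgrPdist_le => eps eps0.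
have Scvg : (fun m => normalized_entropy m + lambda ^- m * letter_cost R d) @ \oo
    --> entropy_rate + 0 * letter_cost R d.
  by apply: cvgD; [exact: cvg_normalized_entropy|apply: cvgMl; exact: cvg_expVn].
have [m ms] : exists m, normalized_entropy m + lambda ^- m * letter_cost R d
    < entropy_rate + eps / 2.
  have : entropy_rate + 0 * letter_cost R d < entropy_rate + eps / 2.
    by rewrite mul0r ltrD2l divr_gt0.
  by move=> /(cvgr_lt _ Scvg _)[m _ ms]; exists m; apply: ms => /=.
have [C HC] := word_entropy_le m.
have Ccvg : (fun n => C * n.+1%:R^-1) @ \oo --> C * 0.
  by apply: cvgMr; exact: cvg_harmonic.
have Cev : \forall n \near \oo, C * n.+1%:R^-1 < eps / 2.
  have eps1 : C * 0 < eps / 2 by rewrite mulr0 divr_gt0.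
  exact: (cvgr_lt _ Ccvg _ eps1).
near=> n; have := entropy_rate_le n; rewrite [word_entropy _ / _]mulrC => le1.
have : C * n.+1%:R^-1 < eps / 2 by near: n.
have : n.+1%:R^-1 * word_entropy n.+1 <=
    normalized_entropy m + lambda ^- m * letter_cost R d + C * n.+1%:R^-1.
  rewrite ler_pdivrMl ?ltr0n//; apply: le_trans (HC n.+1) _.
  by rewrite [leRHS]mulrDr [_ * (C * _)]mulrCA divff ?mulr1// pnatr_eq0.
move: ms le1; move: (n.+1%:R^-1 * _) (C / _) (_ + _) => x y z.
by rewrite ler_norml => *; apply/andP; split; lra.
Unshelve. all: by end_near. Qed.

(** Divided by [lambda^(m+k)], the subadditivity of [pf_entropy] becomes
    [h <= lambda^-k h + s_k] in the limit [m -> oo]. *)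
Lemma entropy_rate_le_pf_entropy k : (0 < k)%N ->
  entropy_rate <= (lambda ^+ k - 1)^-1 * pf_entropy k.
Proof.
move=> k0; have lk : 1 < lambda ^+ k by rewrite exprn_egt1// -lt0n.
have lk0 : 0 < lambda ^+ k := lt_trans ltr01 lk.
have le1 m : normalized_entropy (m + k) <=
    lambda ^- k * normalized_entropy m + normalized_entropy k.
  have -> : lambda ^- k * normalized_entropy m + normalized_entropy k =
      lambda ^- (m + k) * (pf_entropy m + lambda ^+ m * pf_entropy k).
    rewrite /normalized_entropy exprD; field.
    by rewrite !expf_neq0// gt_eqF.
  by rewrite ler_pM2l// pf_entropyD_le.
have : entropy_rate <= lambda ^- k * entropy_rate + normalized_entropy k.
  have shifted : (fun m => normalized_entropy (m + k)) @ \oo --> entropy_rate.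
    by rewrite cvg_shiftn; exact: cvg_normalized_entropy.
  apply: (ler_cvg_to shifted); last by apply: nearW => m; exact: le1.
  apply: cvgD; last exact: cvg_cst.
  by apply: cvgMr; exact: cvg_normalized_entropy.
rewrite /normalized_entropy -mulrDr ler_pdivlMl// ler_pdivlMl ?subr_gt0//; lra.
Qed.

(** At time [m + k] the mean number of cut points is [lambda^-k] times the mean
    length; with this value of [q] the cost of the cut points per letter is the
    binary entropy. *)
Lemma pf_entropy_le_entropy_rate k : (0 < k)%N ->
  lambda ^- k * pf_entropy k - binary_entropy (lambda ^- k) <= entropy_rate.
Proof.
move=> k0; have lk : 1 < lambda ^+ k by rewrite exprn_egt1// -lt0n.
have q01 : 0 < lambda ^- k < 1 by rewrite lambdaX_gt0 invf_lt1// (lt_trans ltr01).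
have shifted : (fun m => normalized_entropy (m + k)) @ \oo --> entropy_rate.
  by rewrite cvg_shiftn; exact: cvg_normalized_entropy.
apply: (cvgr_to_ge shifted); apply: nearW => m.
have := pf_entropyD_ge eigenR Rvec_gt0 Rvec_sum m k q01.
rewrite -(ler_pM2l (lambdaX_gt0 (m + k))).
have l0 : lambda != 0 by rewrite gt_eqF.
have -> : lambda ^- (m + k) * (lambda ^+ m * pf_entropy k) = lambda ^- k * pf_entropy k.
  by rewrite exprD; field; rewrite !expf_neq0.
have -> : lambda ^- (m + k) * (pf_entropy (m + k) - lambda ^+ m * ln (lambda ^- k)
    - (lambda ^+ (m + k) - lambda ^+ m) * ln (1 - lambda ^- k))
    = normalized_entropy (m + k) + binary_entropy (lambda ^- k).
  rewrite /normalized_entropy /binary_entropy exprD; move: (ln _) (ln _) => x y.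
  by field; rewrite !expf_neq0.
by rewrite lerBlDr.
Qed.

End Frequencies.

(** * Identifying the frequency measure *)

(** Each of the two is an eigenvalue, hence bounded by the other. *)
Lemma PF_eigenvalue_uniq (R : realType) (n : nat) (M : 'M[R]_n.+1) (x y : R) :
  PF_eigenvalue M x -> PF_eigenvalue M y -> x = y.
Proof.
have le (a b : R) : PF_eigenvalue M a -> PF_eigenvalue M b -> a <= b.
  move=> [Ma _] [_ /(_ (real_complex R a))].
  rewrite eigenvalue_map => /(_ Ma).
  rewrite normc_def /= expr0n addr0 sqrtr_sqr lecR.
  exact: le_trans (ler_norm a).
by move=> Mx My; apply/eqP; rewrite eq_le !le.
Qed.

Lemma occ_gt0_infix d (v w : seq 'I_d.+1) : (0 < occ v w)%N -> infix v w.
Proof.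
rewrite /occ -has_count => /hasP[i _ /prefixP[t wt]].
by apply/infixP; exists (take i w), t; rewrite -wt cat_take_drop.
Qed.

Section FrequencyMeasure.
Context (R : realType) (d : nat) (theta : random_substitution R d).
Context (lambda : R) (Rvec : 'cV[R]_d.+1) (mu : probability (full_shift d) R).
Local Notation word := (seq 'I_d.+1).
Local Notation iterate k u := (subst_iter theta k u).

Hypothesis eigenR : subst_matrix theta *m Rvec = lambda *: Rvec.
Hypothesis Rvec_gt0 : forall a, 0 < Rvec a 0.
Hypothesis Rvec_sum : \sum_a Rvec a 0 = 1.
Hypothesis lambda_gt1 : 1 < lambda.
Hypothesis mu_freq : frequency_measure theta mu.

Let lambda_gt0 : 0 < lambda. Proof. exact: lt_trans lambda_gt1. Qed.

Definition cylinder_prob (v : word) : R := fine (mu (cylinder theta v)).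

Lemma cylinder_prob_notin v : ~ language theta v -> cylinder_prob v = 0.
Proof.
move=> vL; rewrite /cylinder_prob.
suff -> : cylinder theta v = set0 by rewrite measure0.
apply/seteqP; split => [x [xL xv]|//]; apply: vL.
by rewrite -xv; exact: xL.
Qed.

Lemma Ex_occ_notin v a k : (0 < k)%N -> ~ language theta v ->
  Ex (iterate k [:: a]) (fun w => (occ v w)%:R) = 0.
Proof.
move=> k0 vL; have lk := law_subst_iter theta k [:: a].
rewrite -[RHS](Ex_cst 0 lk); apply: eq_in_Ex => w wk.
apply/eqP; rewrite pnatr_eq0 -leqn0 leqNgt; apply/negP => /occ_gt0_infix vw.
by apply: vL; exists k, a, w; split; rewrite ?Pr_gt0.
Qed.

Lemma cvg_frequency_ratio v a : (fun k => Ex (iterate k [:: a]) (fun w => (occ v w)%:R)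
  / Ex (iterate k [:: a]) (fun w => (size w)%:R)) @ \oo --> cylinder_prob v.
Proof.
case: mu_freq => _ _ lim; have [/lim|vL] := pselect (language theta v); first exact.
rewrite (cylinder_prob_notin vL); apply: cvg_near_cst.
near=> k; rewrite (Ex_occ_notin _ _ vL) ?mul0r//; near: k.
exact: nbhs_infty_gt.
Unshelve. all: by end_near. Qed.

(** The weights [lambda^-k R_a E|theta^k(a)|] are nonnegative and sum to 1, so
    [frequency] is an average of the ratios over the starting letters; this
    replaces their denominators by exact powers of [lambda]. *)
Lemma cvg_frequency v : (frequency theta lambda Rvec)^~ v @ \oo --> cylinder_prob v.
Proof.
pose len k a := Ex (iterate k [:: a]) (fun w : word => (size w)%:R : R).
pose num k a := Ex (iterate k [:: a]) (fun w : word => (occ v w)%:R : R).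
have len0 k a : 0 < len k a.
  have lk := law_subst_iter theta k [:: a].
  apply: lt_le_trans ltr01 _; rewrite -[leLHS](Ex_cst 1 lk).
  by apply: ler_Ex => // w /size_subst_iter; rewrite ler1n.
have lX k : 0 < lambda ^- k by rewrite invr_gt0 exprn_gt0.
have sum1 k : \sum_a lambda ^- k * (Rvec a 0 * len k a) = 1.
  rewrite -mulr_sumr -/(pf_mean theta Rvec k _) (pf_mean_size eigenR)//.
  by rewrite mulVf// gt_eqF// exprn_gt0.
apply/cvgrPdist_le => eps eps0.
have ev : \forall k \near \oo, forall a, `|cylinder_prob v - num k a / len k a| <= eps.
  apply: filter_forall => a.
  by have /cvgrPdist_le := @cvg_frequency_ratio v a; apply.
near=> k.
have -> : cylinder_prob v - frequency theta lambda Rvec k v =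
    \sum_a lambda ^- k * (Rvec a 0 * len k a) * (cylinder_prob v - num k a / len k a).
  under eq_bigr do rewrite mulrBr.
  rewrite sumrB -mulr_suml sum1 mul1r; congr (_ - _).
  rewrite /frequency /pf_mean mulr_sumr; apply: eq_bigr => a _.
  rewrite -!mulrA; congr (_ * (_ * _)).
  by rewrite mulrC divfK// gt_eqF.
apply: le_trans (ler_norm_sum _ _ _) _.
rewrite -[eps]mul1r -(sum1 k) mulr_suml; apply: ler_sum => a _.
have w0 : 0 <= lambda ^- k * (Rvec a 0 * len k a) by rewrite ltW// !mulr_gt0.
rewrite normrM ger0_norm// ler_wpM2l//.
by move: a {w0}; near: k.
Unshelve. all: by end_near. Qed.

Lemma measure_entropyE :
  measure_entropy theta mu = entropy_rate cylinder_prob.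
Proof.
rewrite /measure_entropy.
have -> : (fun n => n%:R^-1 * \sum_(u : n.-tuple 'I_d.+1 | `[< language theta u >])
      - (fine (mu (cylinder theta u)) * ln (fine (mu (cylinder theta u))))) =
    (fun n => n%:R^-1 * word_entropy cylinder_prob n).
  apply/funext => n; rewrite /word_entropy -sum_tupleE big_mkcond; congr (_ * _).
  apply: eq_bigr => u _; case: asboolP => // uL.
  by rewrite (cylinder_prob_notin uL) mul0r oppr0.
apply: cvg_lim => //.
exact: (cvg_word_entropy_rate eigenR Rvec_gt0 Rvec_sum lambda_gt1 cvg_frequency).
Qed.

End FrequencyMeasure.

Unset Implicit Arguments.
Set Strict Implicit.
Set Printing Implicit Defensive.

Theorem theorem3p3 (R : realType) (d : nat) (theta : random_substitution R d)
    (lambda : R) (Rvec : 'cV[R]_d.+1) (mu : probability (full_shift d) R)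
    (theta_primitive : primitive_subst theta)
    (lambda_PF : PF_eigenvalue (subst_matrix theta) lambda)
    (Rvec_PF : right_PF_eigenvector (subst_matrix theta) lambda Rvec)
    (mu_freq : frequency_measure theta mu) :
  (forall k : nat, (0 < k)%N ->
     lambda ^- k * ((entropy_vec theta k)^T *m Rvec) 0 0
       - binary_entropy (lambda ^- k) <= measure_entropy theta mu /\
     measure_entropy theta mu <=
       (lambda ^+ k - 1)^-1 * ((entropy_vec theta k)^T *m Rvec) 0 0) /\
  ((fun k : nat => lambda ^- k * ((entropy_vec theta k)^T *m Rvec) 0 0)
     @ \oo --> measure_entropy theta mu).
Proof.
case: Rvec_PF => eigenR Rvec_gt0 Rvec_sum.
have lambda_gt1 : 1 < lambda.
  by case: theta_primitive => _ [l l_PF l1]; rewrite (PF_eigenvalue_uniq lambda_PF l_PF).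
have freq := cvg_frequency eigenR Rvec_gt0 Rvec_sum lambda_gt1 mu_freq.
have HE k : ((entropy_vec theta k)^T *m Rvec) 0 0 = pf_entropy theta Rvec k.
  by rewrite mxE; apply: eq_bigr => a _; rewrite !mxE mulrC.
rewrite (measure_entropyE eigenR Rvec_gt0 Rvec_sum lambda_gt1 mu_freq).
split=> [k k0|].
  rewrite HE; split.
    exact: (pf_entropy_le_entropy_rate eigenR Rvec_gt0 Rvec_sum lambda_gt1 freq).
  exact: (entropy_rate_le_pf_entropy eigenR Rvec_gt0 Rvec_sum lambda_gt1 freq).
under eq_fun do rewrite HE.
exact: (cvg_normalized_entropy eigenR Rvec_gt0 Rvec_sum lambda_gt1 freq).
Qed.
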